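(* Let $n\ge1$, $p\ge2$, $t_1>0$, $t_2>0$, and let $f\in\mathcal{C}^2(\mathbb{B}^n)\cap\mathcal{H}_g^p(\mathbb{B}^n)$ satisfy $$\Delta\big(|f(z)|^{p}\big)\ge a_{1}(z)\|D_{f}(z)\|^{t_{1}}+b_{1}(z)|f(z)|^{t_{2}}+c_{1}(z)\quad(z\in\mathbb{B}^n),$$ where $a_1,b_1,c_1$ are real-valued nonnegative continuous functions on $\mathbb{B}^n$ with $\inf_{\mathbb{B}^n}a_1+\inf_{\mathbb{B}^n}b_1>0$ and $\inf_{\mathbb{B}^n}c_1\ge0$. (1) If $\inf_{\mathbb{B}^n}a_1>0$, then $f\in\mathcal{D}_{1,t_1}(\mathbb{B}^n)$. (2) If $\inf_{\mathbb{B}^n}b_1>0$, then $f\in b_{1,t_2}(\mathbb{B}^n)$.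
   Context: $\mathbb{B}^n$ is the open unit ball of $\mathbb{C}^n$, $d(z)=1-|z|$, $dV_N$ the normalized volume measure, $d\sigma$ the normalized surface measure on $\partial\mathbb{B}^n$, $\Delta=4\sum_k\partial^2/\partial z_k\partial\overline{z}_k$. $\|D_f\|=\big(\sum_k(|f_{z_k}|^2+|f_{\overline z_k}|^2)\big)^{1/2}$. $\mathcal{H}_g^p(\mathbb{B}^n)$ is the set of measurable $f$ with $M_p(r,f)=\big(\int_{\partial\mathbb{B}^n}|f(r\zeta)|^pd\sigma(\zeta)\big)^{1/p}$ defined for all $r\in(0,1)$ and $\sup_{0<r<1}M_p(r,f)<\infty$. $\mathcal{D}_{\nu,t}(\mathbb{B}^n)$ ($\nu\ge0$, $0<t<\infty$) is the set of $f\in\mathcal{C}^1(\mathbb{B}^n)$ with $\int_{\mathbb{B}^n}d^\nu\|D_f\|^t\,dV_N<\infty$. $b_{\nu,\mu}(\mathbb{B}^n)$ ($\nu>-1$, $0<\mu<\infty$) is the set of continuous $f$ with $\int_{\mathbb{B}^n}d^\nu|f|^\mu\,dV_N<\infty$. *)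

(* Defs.v *)
(* C^n is identified with R^(2n) = 'rV[R]_(n + n): the point z has
   z_k = x_(lshift n k) + i * x_(rshift n k).
   A complex-valued function f is given by its real and imaginary parts
   u = Re f, v = Im f : 'rV[R]_(n + n) -> R. *)
From mathcomp Require Import all_boot all_order all_algebra.
From mathcomp Require Import all_classical all_reals all_analysis.
Set Implicit Arguments. Unset Strict Implicit. Unset Printing Implicit Defensive.
Import Order.TTheory GRing.Theory Num.Theory.
Import numFieldNormedType.Exports.
Local Open Scope classical_set_scope.
Local Open Scope ring_scope.

Section Defs.
Variable R : realType.
Variable n : nat.
Notation V := ('rV[R]_(n + n)).

Definition enorm (x : V) : R := Num.sqrt (\sum_(i < n + n) x ord0 i ^+ 2).

Definition ball1 : set V := [set x | enorm x < 1].

Definition dist1 (x : V) : R := 1 - enorm x.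

Definition cabs (a b : R) : R := Num.sqrt (a ^+ 2 + b ^+ 2).

Definition pd (j : 'I_(n + n)) (g : V -> R) : V -> R :=
  fun x => 'D_(delta_mx 0 j) g x.
Definition dx (k : 'I_n) := pd (lshift n k).
Definition dy (k : 'I_n) := pd (rshift n k).

Definition C1on (U : set V) (g : V -> R) : Prop :=
  (forall x, U x -> (g @ x --> g x)) /\
  (forall j x, U x -> derivable g x (delta_mx 0 j)) /\
  (forall j x, U x -> ((pd j g) @ x --> (pd j g) x)).
Definition C2on (U : set V) (g : V -> R) : Prop :=
  C1on U g /\ forall j, C1on U (pd j g).

(* Wirtinger derivatives of f = u + i v:
   f_{z_k} = (f_x - i f_y)/2,  f_{\bar z_k} = (f_x + i f_y)/2 *)
Definition fz_re (u v : V -> R) k x := (dx k u x + dy k v x) / 2.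
Definition fz_im (u v : V -> R) k x := (dx k v x - dy k u x) / 2.
Definition fzb_re (u v : V -> R) k x := (dx k u x - dy k v x) / 2.
Definition fzb_im (u v : V -> R) k x := (dx k v x + dy k u x) / 2.

Definition normDf (u v : V -> R) (x : V) : R :=
  Num.sqrt (\sum_(k < n)
     (cabs (fz_re u v k x) (fz_im u v k x) ^+ 2
      + cabs (fzb_re u v k x) (fzb_im u v k x) ^+ 2)).

(* Laplacian  Delta = 4 sum_k d^2/dz_k d\bar z_k, acting on a real C^2
   function: sum_k (d^2/dx_k^2 + d^2/dy_k^2) *)
Definition lap (g : V -> R) (x : V) : R :=
  \sum_(k < n) (dx k (dx k g) x + dy k (dy k g) x).

End Defs.
Arguments ball1 {R n}.

(* Lebesgue integral of a nonnegative function on R^m, as the iterated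
   Lebesgue integral (Tonelli) over the coordinates. *)
Fixpoint iint (R : realType) (m : nat) : ('rV[R]_m -> \bar R) -> \bar R :=
  match m return ('rV[R]_m -> \bar R) -> \bar R with
  | 0 => fun g => g 0
  | m'.+1 => fun g =>
      (\int[@lebesgue_measure R]_(t in setT)
          iint (fun y : 'rV[R]_m' => g (row_mx (\row_(_ < 1) t) y)))%E
  end.

Section Integrals.
Variable R : realType.
Variable n : nat.
Notation V := ('rV[R]_(n + n)).

Definition vol_int (g : V -> \bar R) : \bar R :=
  iint (fun x => if enorm x < 1 then g x else 0%E).

Definition intVN (g : V -> \bar R) : \bar R :=
  ((fine (vol_int (fun _ => 1%E)))^-1%:E * vol_int g)%E.

(* integral w.r.t. the normalized surface measure d sigma on the unit sphere,
   sigma being the normalized cone measure: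
   int_S h dsigma = int_B h(x/|x|) dV_N(x). *)
Definition intS (h : V -> \bar R) : \bar R :=
  intVN (fun x => h ((enorm x)^-1 *: x)).

Definition Mpp (p r : R) (u v : V -> R) : \bar R :=
  intS (fun z => ((cabs (u (r *: z)) (v (r *: z))) `^ p)%:E).

Definition Hg (p : R) (u v : V -> R) : Prop :=
  (forall r, 0 < r < 1 -> (Mpp p r u v < +oo)%E) /\
  exists M : R, forall r, 0 < r < 1 -> fine (Mpp p r u v) `^ p^-1 <= M.

Definition Dspace (nu t : R) (u v : V -> R) : Prop :=
  C1on ball1 u /\ C1on ball1 v /\
  (intVN (fun x => (dist1 x `^ nu * normDf u v x `^ t)%:E) < +oo)%E.

Definition bspace (nu mu : R) (u v : V -> R) : Prop :=
  (forall x, ball1 x -> (u @ x --> u x)) /\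
  (forall x, ball1 x -> (v @ x --> v x)) /\
  (intVN (fun x => (dist1 x `^ nu * cabs (u x) (v x) `^ mu)%:E) < +oo)%E.

End Integrals.

(* Main.v *)
Require Import Defs.
From HB Require Import structures.
From mathcomp Require Import all_boot all_order all_algebra.
From mathcomp Require Import all_classical all_reals all_analysis.
From mathcomp Require Import measurable_realfun lra ring.
Import Order.TTheory GRing.Theory Num.Theory.
Import numFieldNormedType.Exports.
Local Open Scope classical_set_scope.
Local Open Scope ring_scope.
(** Write [g = |f|^p] and let [K] be a multiple of [||D_f||^t1] (or of [|f|^t2]) with
    [K <= lap g].  Green's formula against the cutoff [max 0 (r^2 - |x|^2)] is used in a
    discretized form, with second differences of step [h]: by translation invariance they can be
    moved from [g] to the cutoff, where they are nonpositive except on the shell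
    [r - h < |x| < r + h], on which they are at most [2 h].  Since [p >= 2], [g] is [C^2], so its
    second differences dominate [h^2 (K - 1)] uniformly on [|x| <= r] for small [h].  Hence the
    weighted integral of [K] is bounded by [1 / h] times the integral of [g] over the shell, plus
    a constant.  A polar-coordinates inequality, obtained from Tonelli and dilations alone,
    bounds the shell integral by [h] times the supremum of the spherical means of [g].
    Finally [r] tends to [1], and [1 - |x| <= 1 - |x|^2]. *)

Set Implicit Arguments. Unset Strict Implicit. Unset Printing Implicit Defensive.

(** Discretizing avoids boundary terms and differentiation under the integral: once g is extended by
    0, summation by parts is just invariance of the integral under x -> x + h e_j and x -> x - h
    e_j. The powers of h balance. The kink has size 2 h on a shell whose integral is O(h), so it
    contributes O(h^2), the same order as the second differences, and h^2 can be divided out. The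
    admissible h depends on r, but the final bound depends on neither, which is what lets r tend to
    1. Only an upper bound on the shell is needed, so a one-sided polar inequality with a crude
    constant replaces the polar-coordinates formula. The analytic obstacle is the zero set of f: the
    second derivative of (u^2 + v^2)^(p/2) contains a quotient by u^2 + v^2. For p > 2 the
    Cauchy-Schwarz inequality makes this term tend to 0 at a zero of f; for p = 2 its coefficient is
    0. *)

(** * The iterated integral as an integral against a sigma-finite measure *)

Section RowMeasure.
Context {R : realType}.
Local Notation lam := (@lebesgue_measure R).
Local Notation mR := (measurableTypeR R).

(** Tuples carry the product sigma-algebra, so measurability of functions of row vectors is
    expressed by transport along this bijection. *)
Definition tup2row {m} (t : m.-tuple mR) : 'rV[R]_m := \row_i tnth t i.

Definition row2tup {m} (x : 'rV[R]_m) : m.-tuple mR := [tuple x ord0 i | i < m].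

Lemma row2tupK {m} : cancel (@row2tup m) tup2row.
Proof. by move=> x; apply/rowP => i; rewrite mxE tnth_mktuple. Qed.

Definition rmeasurable {m} (f : 'rV[R]_m -> \bar R) : Prop :=
  measurable_fun setT (f \o tup2row).

Definition rmap {d} {T : measurableType d} {m} (h : T -> 'rV[R]_m) : Prop :=
  forall i, measurable_fun setT (fun t => h t ord0 i : mR).

Lemma rmap_tup2row m : rmap (@tup2row m).
Proof.
move=> i; rewrite (_ : (fun t => _) = (fun t => tnth t i)); last first.
  by apply/funext => t; rewrite mxE.
exact: measurable_tnth.
Qed.

Lemma rmap_row2tup d (T : measurableType d) m (h : T -> 'rV[R]_m) :
  rmap h -> measurable_fun setT (row2tup \o h).
Proof.
move=> mh; apply/measurable_fun_tnthP => i.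
rewrite (_ : _ \o _ = (fun t => h t ord0 i)); first exact: mh.
by apply/funext => t /=; rewrite tnth_mktuple.
Qed.

Lemma rmeasurable_comp d (T : measurableType d) m (f : 'rV[R]_m -> \bar R)
  (h : T -> 'rV[R]_m) : rmeasurable f -> rmap h -> measurable_fun setT (f \o h).
Proof.
move=> mf mh; rewrite (_ : f \o h = (f \o tup2row) \o (row2tup \o h)).
  by apply: measurableT_comp => //; exact: rmap_row2tup.
by apply/funext => t /=; rewrite row2tupK.
Qed.

Lemma tup2row_cons m (s : mR) (t : m.-tuple mR) :
  tup2row [tuple of s :: t] = row_mx (\row_(_ < 1) s) (tup2row t).
Proof.
apply/rowP => i; rewrite !mxE; case: splitP => j ij.
  by rewrite mxE (_ : i = ord0)//; apply/val_inj; rewrite /= ij (ord1 j).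
rewrite mxE (_ : i = lift ord0 j) ?tnthS//.
by apply/val_inj; rewrite /= ij /bump.
Qed.

Lemma rmap_row_mx d (T : measurableType d) m (a : T -> mR) (h : T -> 'rV[R]_m) :
  measurable_fun setT a -> rmap h ->
  rmap (fun t => row_mx (\row_(_ < 1) (a t : R)) (h t)).
Proof.
move=> ma mh i.
have [j ij|j ij] := splitP i; under eq_fun do rewrite mxE /=.
  case: splitP => k; rewrite ij => jk; first by under eq_fun do rewrite mxE.
  by exfalso; move: jk; rewrite (ord1 j).
case: splitP => k; rewrite ij => jk; last exact: mh.
by exfalso; move: jk; rewrite (ord1 k).
Qed.

Lemma sigma_finite_pushforward d1 d2 (T1 : measurableType d1)
  (T2 : measurableType d2) (mu : {measure set T1 -> \bar R})
  (f : T1 -> T2) (g : T2 -> T1) : sigma_finite setT mu ->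
  measurable_fun setT f -> measurable_fun setT g -> cancel f g ->
  exists nu : {sigma_finite_measure set T2 -> \bar R},
    nu = pushforward mu f :> (set T2 -> \bar R).
Proof.
move=> [F TF Foo] mf mg fK.
pose nu : {measure set T2 -> \bar R} :=
  measure_function_pushforward__canonical__measure_function_Measure mu mf.
have sf : sigma_finite setT nu.
  exists (fun i => g @^-1` F i).
    by rewrite -preimage_bigcup -TF preimage_setT.
  move=> i; have [mF Fi] := Foo i; split.
    by rewrite -[X in measurable X]setTI; exact: mg.
  rewrite /= /pushforward -comp_preimage (_ : g \o f = id)//.
  by apply/funext => x /=; rewrite fK.
pose H := @Measure_isSigmaFinite.Build _ T2 R nu sf.
by exists (HB.pack_for (SigmaFiniteMeasure.type T2 R) (Measure.sort nu) H).
Qed.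

Lemma sigma_finite_prod d1 d2 (T1 : measurableType d1) (T2 : measurableType d2)
  (m1 : {sigma_finite_measure set T1 -> \bar R})
  (m2 : {sigma_finite_measure set T2 -> \bar R}) : sigma_finite setT (m1 \x m2)%E.
Proof.
have /sigma_finiteP[F [TF ndF Foo]] := sigma_finiteT m1.
have /sigma_finiteP[G [TG ndG Goo]] := sigma_finiteT m2.
(* Both exhausting sequences are taken nondecreasing, so that the larger of two indices serves both
   coordinates. *)
exists (fun n => F n `*` G n).
  apply/esym; rewrite -subTset => -[x y] _.
  have [i _ Fx] : (\bigcup_i F i) x by rewrite -TF.
  have [j _ Gy] : (\bigcup_j G j) y by rewrite -TG.
  exists (maxn i j) => //; split.
    by have /subsetPset := ndF _ _ (leq_maxl i j); exact.
  by have /subsetPset := ndG _ _ (leq_maxr i j); exact.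
move=> i; have [mF Fi] := Foo i; have [mG Gi] := Goo i.
split; first exact: measurableX.
by rewrite product_measure1E// lte_mul_pinfty// ge0_fin_numE.
Qed.

(** Induction on the dimension: the measure on (m+1)-tuples is the image of [lam \x mu] under
    consing, and Tonelli identifies its integral with one more iterated integration. Every later
    property of [iint] (additivity, monotone convergence, exchange) is inherited through this
    representation. *)
Lemma iint_measure m : exists mu : {sigma_finite_measure set (m.-tuple mR) -> \bar R},
  forall f : 'rV[R]_m -> \bar R, (forall x, 0 <= f x)%E -> rmeasurable f ->
  iint f = (\int[mu]_t f (tup2row t))%E.
Proof.
elim: m => [|m [mu IH]].
  have mm : sigma_finite setT (@dirac _ (0.-tuple mR) [tuple] R).
    by exists (fun=> setT) => [|i]; [rewrite bigcup_const|rewrite diracT ltry].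
  pose d0 : {measure set (0.-tuple mR) -> \bar R} := @dirac _ (0.-tuple mR) [tuple] R.
  pose H := @Measure_isSigmaFinite.Build _ _ R d0 mm.
  pose nu : {sigma_finite_measure set (0.-tuple mR) -> \bar R} :=
    HB.pack_for (SigmaFiniteMeasure.type (0.-tuple mR) R) (Measure.sort d0) H.
  exists nu => f f0 mf; rewrite /= integral_dirac//.
  by rewrite diracT mul1e; congr f; apply/rowP => -[].
pose phi (p : mR * m.-tuple mR) : m.+1.-tuple mR := [tuple of p.1 :: p.2].
pose psi (t : m.+1.-tuple mR) : mR * m.-tuple mR := (thead t, [tuple of behead t]).
have mphi : measurable_fun setT phi by apply: measurable_cons.
have mpsi : measurable_fun setT psi.
  apply/measurable_fun_pair; first exact: measurable_tnth.
  exact: measurable_behead.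
have psiK : cancel phi psi.
  by move=> [s t]; rewrite /psi /phi; congr pair; exact/val_inj.
have [nu nuE] := sigma_finite_pushforward (sigma_finite_prod lam mu) mphi mpsi psiK.
exists nu => f f0 mf.
have mf' : measurable_fun setT ((f \o tup2row) \o phi) by exact: measurableT_comp.
transitivity (\int[lam]_s \int[mu]_t ((f \o tup2row) \o phi) (s, t))%E.
  apply: eq_integral => s _; rewrite [LHS](IH (fun y => f (row_mx (\row_(_ < 1) (s : R)) y)))//.
    by apply: eq_integral => t _ /=; rewrite tup2row_cons.
  have mp : rmap (fun t : m.-tuple mR => row_mx (\row_(_ < 1) (s : R)) (tup2row t)).
    by apply: rmap_row_mx => //; exact: rmap_tup2row.
  exact: (rmeasurable_comp mf mp).
rewrite -(@fubini_tonelli1 _ _ _ _ _ lam mu _ mf' (fun p => f0 _)).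
rewrite -(@ge0_integral_pushforward _ _ _ _ _ _ mphi (lam \x mu)%E setT
  _ measurableT mf (fun y _ => f0 _)).
by apply: eq_measure_integral => A mA _; have := congr1 (fun m => m A) nuE.
Qed.

Definition rvol m : {sigma_finite_measure set (m.-tuple mR) -> \bar R} :=
  projT1 (cid (iint_measure m)).

Lemma iintE m (f : 'rV[R]_m -> \bar R) : (forall x, 0 <= f x)%E -> rmeasurable f ->
  iint f = (\int[rvol m]_t f (tup2row t))%E.
Proof. by move=> f0 mf; rewrite /rvol; case: cid => /= mu ->. Qed.

Lemma iint_ge0 m (f : 'rV[R]_m -> \bar R) : (forall x, 0 <= f x)%E -> (0 <= iint f)%E.
Proof.
elim: m f => [|m IH] f f0; first exact: f0.
by apply: integral_ge0 => s _; exact: IH.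
Qed.

Lemma eq_iint m (f g : 'rV[R]_m -> \bar R) : f =1 g -> iint f = iint g.
Proof. by move=> fg; congr iint; exact/funext. Qed.

Lemma le_iint m (f g : 'rV[R]_m -> \bar R) : (forall x, 0 <= f x)%E ->
  rmeasurable f -> rmeasurable g -> (forall x, f x <= g x)%E -> (iint f <= iint g)%E.
Proof.
move=> f0 mf mg fg; have g0 x : (0 <= g x)%E by exact: le_trans (fg x).
by rewrite !iintE//; exact: ge0_le_integral.
Qed.

Lemma iint0 m (f : 'rV[R]_m -> \bar R) : (forall x, f x = 0)%E -> iint f = 0%E.
Proof.
elim: m f => [|m IH] f f0; first exact: f0.
by apply: integral0_eq => s _; exact: IH.
Qed.

Lemma iintD m (f g : 'rV[R]_m -> \bar R) :
  (forall x, 0 <= f x)%E -> rmeasurable f -> (forall x, 0 <= g x)%E -> rmeasurable g ->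
  iint (fun x => f x + g x)%E = (iint f + iint g)%E.
Proof.
move=> f0 mf g0 mg; rewrite (iintE f0 mf) (iintE g0 mg) iintE => [|x|].
- by rewrite ge0_integralD.
- by rewrite adde_ge0.
- exact: emeasurable_funD.
Qed.

Lemma iintZ m (k : R) (f : 'rV[R]_m -> \bar R) : 0 <= k ->
  (forall x, 0 <= f x)%E -> rmeasurable f ->
  iint (fun x => k%:E * f x)%E = (k%:E * iint f)%E.
Proof.
move=> k0 f0 mf; rewrite (iintE f0 mf) iintE => [|x|].
- by rewrite ge0_integralZl_EFin.
- by rewrite mule_ge0.
- exact: measurable_funeM.
Qed.

Lemma iint_sum m (I : Type) (r : seq I) (F : I -> 'rV[R]_m -> \bar R) :
  (forall i x, 0 <= F i x)%E -> (forall i, rmeasurable (F i)) ->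
  iint (fun x => \sum_(i <- r) F i x)%E = (\sum_(i <- r) iint (F i))%E.
Proof.
move=> F0 mF; elim: r => [|i r IH].
  rewrite big_nil (_ : (fun x => _) = fun x => 0%:E * cst 0 x)%E; last first.
    by apply/funext => x; rewrite big_nil mule0.
  by rewrite iintZ ?mul0e//; exact: measurable_cst.
rewrite big_cons -IH -iintD => [| | |x|] //.
- by apply: eq_iint => x; rewrite big_cons.
- exact: sume_ge0.
- exact: (@emeasurable_sum _ _ _ _ _ _ (fun i => F i \o tup2row) mF).
Qed.

Lemma iint_monotone m (F : nat -> 'rV[R]_m -> \bar R) (f : 'rV[R]_m -> \bar R) C :
  (forall k x, 0 <= F k x)%E -> (forall k, rmeasurable (F k)) ->
  (forall x j k, (j <= k)%N -> F j x <= F k x)%E ->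
  (forall x, F ^~ x @ \oo --> f x) ->
  (forall k, iint (F k) <= C)%E -> (iint f <= C)%E.
Proof.
move=> F0 mF ndF Ff FC.
have f0 x : (0 <= f x)%E.
  by apply: (cvge_to_ge (Ff x)); exact: nearW.
have mf : rmeasurable f.
  apply: (emeasurable_fun_cvg (fun k => F k \o tup2row)) => // t _; exact: Ff.
have cv : iint (F k) @[k --> \oo] --> iint f.
  rewrite iintE//; under eq_fun do rewrite iintE//.
  rewrite (_ : (\int[_]_t f _)%E = (\int[rvol m]_t limn (fun k => F k (tup2row t)))%E).
    apply: cvg_monotone_convergence => // [t _ j k jk]; exact: ndF.
  by apply: eq_integral => t _; apply/esym/cvg_lim => //; exact: Ff.
by apply: (cvge_to_le cv); exact: nearW.
Qed.

Lemma measurable_iint d (T : measurableType d) m (F : T -> 'rV[R]_m -> \bar R) :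
  (forall t x, 0 <= F t x)%E ->
  measurable_fun setT (fun p : T * m.-tuple mR => F p.1 (tup2row p.2)) ->
  measurable_fun setT (fun t => iint (F t)).
Proof.
move=> F0 mF; under eq_fun => t.
  rewrite iintE//; last by have := measurableT_comp mF (pair1_measurable t).
  over.
exact: (@measurable_fun_fubini_tonelli_F _ _ _ _ _ (rvol m) _ mF).
Qed.

Lemma iint_exchange m (F : mR -> 'rV[R]_m -> \bar R) :
  (forall t x, 0 <= F t x)%E ->
  measurable_fun setT (fun p : mR * m.-tuple mR => F p.1 (tup2row p.2)) ->
  (\int[lam]_s iint (F s) = iint (fun x => \int[lam]_s F s x))%E.
Proof.
move=> F0 mF; rewrite iintE => [|x|].
- under eq_integral => s _.
    rewrite iintE//; last by have := measurableT_comp mF (pair1_measurable s).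
    over.
  exact: (@fubini_tonelli _ _ _ _ _ lam (rvol m) _ mF).
- exact: integral_ge0.
- exact: (@measurable_fun_fubini_tonelli_G _ _ _ _ _ lam _ mF).
Qed.

(** The image of Lebesgue measure under s -> c s + a, multiplied by c, gives each interval ]x, y]
    its length; by uniqueness it is Lebesgue measure, and the formula is integration against an
    image measure. *)
Lemma integral_affine (c a : R) (f : mR -> \bar R) : 0 < c ->
  (forall x, 0 <= f x)%E -> measurable_fun setT f ->
  (\int[lam]_s f (c * s + a)%R = c^-1%:E * \int[lam]_s f s)%E.
Proof.
move=> c0 f0 mf.
pose phi (s : mR) : mR := c * s + a.
have mphi : measurable_fun setT phi.
  by apply: measurable_funD => //; exact: measurable_funM.
have cne0 : (c%:E != 0)%E by rewrite eqe gt_eqF.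
suff -> : (\int[lam]_s f s = c%:E * \int[lam]_s f (phi s))%E.
  by rewrite muleA -EFinM mulVf ?gt_eqF// mul1e.
rewrite -[X in (_ * X)%E](@ge0_integral_pushforward _ _ _ _ _ _ mphi lam setT
  f measurableT mf (fun y _ => f0 _)).
rewrite -(@ge0_integral_mscale _ _ _ _ _ measurableT (NngNum (ltW c0)) _ mf)//.
apply: eq_measure_integral => A mA _.
apply: lebesgue_measure_unique => // _ [[x y]] _ <-.
transitivity (c%:E * lam (phi @^-1` `]x, y]))%E; last by [].
rewrite (_ : phi @^-1` _ = `](x - a) / c, (y - a) / c]%classic).
  rewrite !lebesgue_measure_itv/= !lte_fin ltr_pM2r ?invr_gt0// ltrD2r.
  case: ifPn => _; last by rewrite mule0.
  by rewrite -!EFinD -EFinM; congr EFin; field; rewrite gt_eqF.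
apply/seteqP; split => s /=; rewrite !in_itv/= /phi ltr_pdivrMr// ler_pdivlMr//.
  by rewrite ltrBlDr lerBrDr mulrC.
by rewrite ltrBlDr lerBrDr mulrC.
Qed.

(** Each coordinate contributes one factor 1/c. The case c = 1 is translation invariance; the case a
    = 0 gives the dilations behind the polar inequality. *)
Lemma iint_affine (c : R) m (a : 'rV[R]_m) (f : 'rV[R]_m -> \bar R) : 0 < c ->
  (forall x, 0 <= f x)%E -> rmeasurable f ->
  iint (fun x => f (c *: x + a)) = ((c ^- m)%:E * iint f)%E.
Proof.
move=> c0; elim: m a f => [|m IH] a f f0 mf.
  rewrite /= expr0 invr1 mul1e; congr f; by apply/rowP => -[].
have mf2 s : rmeasurable (fun y => f (row_mx (\row_(_ < 1) s) y)).
  have mp : rmap (fun t : m.-tuple mR => row_mx (\row_(_ < 1) s) (tup2row t)).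
    by apply: rmap_row_mx => //; exact: rmap_tup2row.
  exact: (rmeasurable_comp mf mp).
have mg : measurable_fun setT (fun s : mR => iint (fun y => f (row_mx (\row_(_ < 1) (s : R)) y))).
  apply: measurable_iint => //.
  have mp : rmap (fun p : mR * m.-tuple mR => row_mx (\row_(_ < 1) (p.1 : R)) (tup2row p.2)).
    apply: rmap_row_mx => // i.
    exact: (measurableT_comp (rmap_tup2row i)).
  exact: (rmeasurable_comp mf mp).
pose a' : 'rV[R]_m := \row_i a ord0 (rshift 1 i).
transitivity (\int[lam]_s ((c ^- m)%:E *
    iint (fun y => f (row_mx (\row_(_ < 1) (c * s + a ord0 ord0)%R) y))))%E.
  apply: eq_integral => s _; rewrite -(IH a')//.
  apply: eq_iint => y; congr f; apply/rowP => i; rewrite !mxE.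
  case: splitP => j ij; rewrite !mxE.
    by congr (_ + a _ _); apply/val_inj; rewrite /= ij (ord1 j).
  by congr (_ + a _ _); apply/val_inj; rewrite /= ij.
rewrite ge0_integralZl_EFin//.
- rewrite (@integral_affine c (a ord0 ord0) (fun s : mR => iint (fun y => f (row_mx (\row_(_ < 1) (s : R)) y))))//.
    by rewrite muleA -EFinM exprS invfM mulrC.
  by move=> s; exact: iint_ge0.
- by move=> s _; exact: iint_ge0.
- have ma : measurable_fun setT (fun s : mR => c * s + a ord0 ord0 : mR).
    by apply: measurable_funD => //; exact: measurable_funM.
  exact: (measurableT_comp mg ma).
- by rewrite invr_ge0 exprn_ge0 // ltW.
Qed.

Lemma rmeasurable_box (a : R) m :
  rmeasurable (fun x : 'rV[R]_m => (\prod_i (if `|x ord0 i| <= a then 1 else 0)%R)%:E).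
Proof.
apply/measurable_EFinP; apply: measurable_prod => i _.
apply: measurable_fun_ifT => //; apply: measurable_fun_ler => //.
by apply: measurableT_comp => //; exact: rmap_tup2row.
Qed.

(** Cubes are the sets whose volume is computed exactly; comparison with them shows that the unit
    ball has finite positive volume. *)
Lemma iint_box (a : R) m : 0 <= a ->
  iint (fun x : 'rV[R]_m => (\prod_i (if `|x ord0 i| <= a then 1 else 0)%R)%:E) = ((a *+ 2) ^+ m)%:E.
Proof.
move=> a0; elim: m => [|m IH]; first by rewrite /= big_ord0.
transitivity (\int[lam]_s (((a *+ 2) ^+ m)%:E * (\1_(`[- a, a]%classic) s)%:E))%E.
  apply: eq_integral => s _; rewrite muleC -IH -iintZ//.
  - apply: eq_iint => y; rewrite big_ord_recl -EFinM; congr (_ * _)%:E.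
      rewrite mxE; case: splitP => j // _; rewrite mxE indicE.
      by rewrite ler_norml mem_setE in_itv/=; case: ifP.
    apply: eq_bigr => i _; rewrite mxE; case: splitP => j ij.
      by exfalso; move: ij; rewrite (ord1 j).
    have -> // : j = i by apply/val_inj; move: ij => /= [].
  - by move=> x; rewrite lee_fin prodr_ge0// => i _; case: ifP.
  - exact: rmeasurable_box.
rewrite ge0_integralZl_EFin; [|by []|by move=> s _; rewrite lee_fin indicE ler0n|
  exact/measurable_EFinP/measurable_indic|by rewrite exprn_ge0// mulrn_wge0].
rewrite integral_indic// setIT [X in (_ * X)%E]lebesgue_measure_itv/= lte_fin.
case: ifPn => [_|]; first by rewrite -EFinD -EFinM opprK -mulr2n exprSr.
rewrite -leNgt => aN; have -> : a = 0 by lra.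
by rewrite mule0 mul0rn expr0n.
Qed.

End RowMeasure.

(** * Open sets of row vectors are measurable for the product sigma-algebra *)

Section RowOpen.
Context {R : realType}.
Local Notation mR := (measurableTypeR R).

Lemma measurable_row_box m (q : 'rV[R]_m) (e : R) :
  measurable (@tup2row R m @^-1` [set x | forall i, `|x ord0 i - q ord0 i| <= e]).
Proof.
rewrite (_ : _ @^-1` _ = ~` \bigcup_i ~` ((fun t : m.-tuple mR =>
    (`|tup2row t ord0 i - q ord0 i| <= e)%R) @^-1` [set true])); last first.
  rewrite setC_bigcup; apply/seteqP; split => t /= tq i.
    by move=> _; rewrite setCK /=; exact: tq.
  by have := tq i Logic.I; rewrite setCK.
apply/measurableC/countable_bigcupT_measurable => [|i]; first exact: countableP.
apply: measurableC; rewrite -[X in measurable X]setTI.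
apply: measurable_fun_ler => //; apply: measurableT_comp => //.
by apply: measurable_funB => //; exact: rmap_tup2row.
Qed.

(** An open set is the union of the closed cubes with rational centre and radius 1/(k+1) that it
    contains; there are countably many. *)
Lemma open_rmeasurable m (U : set 'rV[R]_m) : open U ->
  measurable (@tup2row R m @^-1` U).
Proof.
move=> oU.
pose q2r (q : 'rV[rat]_m) : 'rV[R]_m := map_mx ratr q.
pose box (p : 'rV[rat]_m * nat) : set 'rV[R]_m :=
  [set x | forall i, `|x ord0 i - q2r p.1 ord0 i| <= p.2.+1%:R^-1].
pose B p : set 'rV[R]_m := if asbool (box p `<=` U) then box p else set0.
have UB : U = \bigcup_p B p.
  apply/seteqP; split => x; last first.
    by move=> [p _]; rewrite /B; case: asboolP => // + xB; exact.
  move=> Ux; have /nbhs_ballP[e /= e0 eU] : nbhs x U by exact: open_nbhs_nbhs.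
  (* The radius 1/(k+1) is below e/2, so a cube of this radius containing [x] has all its points
     within e of [x]. *)
  pose k := Num.truncn (2 / e).
  have ke : k.+1%:R^-1 < e / 2 :> R.
    by rewrite -[e / 2]invf_div ltf_pV2 ?posrE ?divr_gt0// truncnS_gt.
  have qP i : exists q : rat, `|x ord0 i - ratr q| <= k.+1%:R^-1.
    have k0 : 0 < k.+1%:R^-1 :> R by rewrite invr_gt0.
    have [|q] := @rat_in_itvoo R (x ord0 i - k.+1%:R^-1) (x ord0 i + k.+1%:R^-1).
      by rewrite ltrBlDr -addrA ltrDl addr_gt0.
    rewrite in_itv/= => /andP[q1 q2]; exists q; rewrite ler_distlC.
    by rewrite lerBlDr -lerBlDr !ltW// lerBlDr.
  pose q : 'rV[rat]_m := \row_i projT1 (cid (qP i)).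
  have xq : box (q, k) x.
    by move=> i; rewrite /= !mxE; case: cid.
  exists (q, k) => //; rewrite /B; case: asboolP => // -[]; move=> y yq; apply: eU.
  split=> // i j; rewrite /ball/= (ord1 i).
  rewrite (_ : x _ _ - _ = (x ord0 j - q2r q ord0 j) - (y ord0 j - q2r q ord0 j)); last by lra.
  rewrite (le_lt_trans (ler_normB _ _))// (splitr e) ltr_leD//.
    exact: le_lt_trans (xq j) _.
  exact: le_trans (yq j) (ltW _).
rewrite UB preimage_bigcup; apply: countable_bigcupT_measurable => [|p].
  exact: countableP.
rewrite /B; case: ifPn => _; last by rewrite preimage_set0.
exact: measurable_row_box.
Qed.

Lemma rmeasurable_if m (U : set 'rV[R]_m) (f : 'rV[R]_m -> R) : open U ->
  (forall x, U x -> f @ x --> f x) ->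
  measurable_fun setT (fun t => if asbool (U (tup2row t)) then f (tup2row t) else 0 : mR).
Proof.
move=> oU cf; apply: measurable_fun_if => //.
  apply: (measurable_fun_bool true); rewrite setTI.
  rewrite (_ : _ @^-1` _ = @tup2row R m @^-1` U); first exact: open_rmeasurable.
  by apply/seteqP; split => t /= /asboolP.
rewrite setTI (_ : _ @^-1` _ = @tup2row R m @^-1` U); last first.
  by apply/seteqP; split => t /= /asboolP.
apply: (measurability (RGenOInfty.G (R:=R))); first exact: RGenOInfty.measurableE.
move=> _ [_ [a ->] <-].
rewrite (_ : _ `&` _ = @tup2row R m @^-1` (U `&` [set x | a < f x])); last first.
  by apply/seteqP; split => t /=; rewrite in_itv/= andbT.
apply: open_rmeasurable; rewrite openE => x [Ux ax].
near=> y; split => /=; near: y; first exact: open_nbhs_nbhs.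
exact: (cvgr_gt _ (cf x Ux)).
Unshelve. all: by end_near. Qed.

End RowOpen.

(** * The Euclidean norm, its measurability, and the volume of the unit ball *)

Section EuclideanNorm.
Context {R : realType} {n : nat}.
Local Notation V := ('rV[R]_(n + n)).
Local Notation mR := (measurableTypeR R).
Implicit Types x y : V.

Lemma enorm_ge0 x : 0 <= enorm x.
Proof. exact: sqrtr_ge0. Qed.

Lemma sqr_enorm x : enorm x ^+ 2 = \sum_i x ord0 i ^+ 2.
Proof. by rewrite sqr_sqrtr// sumr_ge0// => i _; exact: sqr_ge0. Qed.

Lemma enormZ (c : R) x : enorm (c *: x) = `|c| * enorm x.
Proof.
rewrite /enorm -sqrtr_sqr -sqrtrM ?sqr_ge0//; congr Num.sqrt.
by rewrite mulr_sumr; apply: eq_bigr => i _; rewrite !mxE exprMn.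
Qed.

Lemma coord_le_enorm x i : `|x ord0 i| <= enorm x.
Proof.
rewrite -ler_sqr ?nnegrE ?enorm_ge0// sqr_enorm real_normK ?num_real//.
by rewrite (bigD1 i)//= lerDl sumr_ge0// => j _; exact: sqr_ge0.
Qed.

Lemma sqr_enormD_delta x (h : R) j :
  enorm (x + h *: delta_mx 0 j) ^+ 2 = enorm x ^+ 2 + 2 * h * x ord0 j + h ^+ 2.
Proof.
rewrite !sqr_enorm (bigD1 j)//= [in RHS](bigD1 j)//= !mxE !eqxx mulr1.
under eq_bigr => i ij.
  rewrite !mxE (negbTE ij) andbF mulr0 addr0.
  over.
by ring.
Qed.

Lemma enormD_delta x (h : R) j :
  enorm (x + h *: delta_mx 0 j) <= enorm x + `|h|.
Proof.
rewrite -ler_sqr ?nnegrE ?addr_ge0 ?enorm_ge0// sqr_enormD_delta sqrrD.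
rewrite real_normK ?num_real// lerD2r lerD2l -mulrnAr -mulr_natl.
have : h * x ord0 j <= enorm x * `|h|.
  by rewrite (le_trans (ler_norm _))// normrM mulrC ler_wpM2r// coord_le_enorm.
lra.
Qed.

Lemma cvg_sumr {T : Type} (F : set_system T) (FF : Filter F) (I : Type) (r : seq I)
  (f : I -> T -> R) (l : I -> R) : (forall i, f i t @[t --> F] --> l i) ->
  \sum_(i <- r) f i t @[t --> F] --> \sum_(i <- r) l i.
Proof.
move=> fl; elim: r => [|i r IH].
  by rewrite big_nil; under eq_fun do rewrite big_nil; exact: cvg_cst.
by rewrite big_cons; under eq_fun do rewrite big_cons; exact: cvgD.
Qed.

Lemma enorm_continuous : continuous (@enorm R n).
Proof.
move=> x; apply: (@continuous_comp _ _ _ (fun x : V => \sum_i x ord0 i ^+ 2) Num.sqrt).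
  apply: (@cvg_sumr V (nbhs x) (nbhs_filter x) _ _ (fun i y => y ord0 i ^+ 2)) => i.
  exact: (cvgM (@coord_continuous R _ _ ord0 i x) (@coord_continuous R _ _ ord0 i x)).
exact: sqrt_continuous.
Qed.

Lemma open_ball1 : open (@ball1 R n).
Proof.
apply: (@open_comp _ _ (@enorm R n) [set y | y < 1]); last exact: open_lt.
by move=> x _; exact: enorm_continuous.
Qed.

Lemma measurable_enorm d (T : measurableType d) (h : T -> V) : rmap h ->
  measurable_fun setT (fun t => enorm (h t) : mR).
Proof.
move=> mh; apply: (measurableT_comp (continuous_measurable_fun (@sqrt_continuous R))).
by apply: measurable_sum => i; apply: measurable_funX; exact: mh.
Qed.

Lemma rmap_normalize d (T : measurableType d) (a : T -> mR) (h : T -> V) :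
  measurable_fun setT a -> rmap h ->
  rmap (fun t => (a t : R) *: ((enorm (h t))^-1 *: h t)).
Proof.
move=> ma mh i; under eq_fun do rewrite !mxE -powR_inv1 ?enorm_ge0//.
apply: measurable_funM => //; apply: measurable_funM; last exact: mh.
apply: (measurableT_comp (measurable_powR _)); exact: measurable_enorm.
Qed.

Lemma rmap_scale d (T : measurableType d) (a : T -> mR) (h : T -> V) :
  measurable_fun setT a -> rmap h -> rmap (fun t => (a t : R) *: h t).
Proof.
by move=> ma mh i; under eq_fun do rewrite !mxE; apply: measurable_funM => //; exact: mh.
Qed.

Lemma rmeasurable_ball (f : V -> \bar R) : rmeasurable f ->
  rmeasurable (fun x => if enorm x < 1 then f x else 0%E).
Proof.
move=> mf; apply: measurable_fun_ifT => //; apply: measurable_fun_ltr => //.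
by apply: measurable_enorm; exact: rmap_tup2row.
Qed.

Lemma vol_ball_lty : (vol_int (fun _ : V => 1%E) < +oo)%E.
Proof.
apply: (@le_lt_trans _ _ ((1 *+ 2) ^+ (n + n))%:E); last exact: ltry.
rewrite -(@iint_box R 1)//; apply: le_iint.
- by move=> x; case: ifP.
- by apply: rmeasurable_ball; exact: measurable_cst.
- exact: rmeasurable_box.
- move=> x; case: ifPn => [x1|_].
    rewrite big1// => i _; case: ifPn => //; rewrite -ltNge => xi.
    by have := le_lt_trans (coord_le_enorm x i) x1; rewrite ltNge (ltW xi).
  by rewrite lee_fin prodr_ge0// => i _; case: ifP.
Qed.

Lemma vol_ball_gt0 : (0 < vol_int (fun _ : V => 1%E))%E.
Proof.
(* The cube of half-side a = 1/(2n+1) lies in the ball: since a <= 1, each squared coordinate is at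
   most a, and 2n of them sum to less than 1. *)
pose a : R := (n + n).+1%:R^-1.
have a0 : 0 < a by rewrite invr_gt0.
apply: (@lt_le_trans _ _ ((a *+ 2) ^+ (n + n))%:E).
  by rewrite lte_fin exprn_gt0// mulrn_wgt0.
rewrite -(@iint_box R a) ?(ltW a0)//; apply: le_iint.
- by move=> x; rewrite lee_fin prodr_ge0// => i _; case: ifP.
- exact: rmeasurable_box.
- by apply: rmeasurable_ball; exact: measurable_cst.
- move=> x; have [xa|/existsNP[i /negP xi]] := pselect (forall i, `|x ord0 i| <= a); last first.
    rewrite (bigD1 i)//= (negbTE xi) mul0r; by case: ifP.
  rewrite big1 => [|i _]; last by rewrite xa.
  case: ifPn => //; rewrite -leNgt => x1; exfalso.
  have : enorm x ^+ 2 < 1.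
    rewrite sqr_enorm (@le_lt_trans _ _ (\sum_(i < n + n) a))//.
      apply: ler_sum => i _; rewrite -real_normK ?num_real// expr2.
      rewrite -[leRHS]mul1r ler_pM// (le_trans (xa i))// /a invf_le1 ?ler1n//.
    rewrite sumr_const card_ord -mulr_natl ltr_pdivrMr// mul1r.
    by rewrite ltr_nat.
  by rewrite ltNge exprn_ege1.
Qed.

End EuclideanNorm.

(** * A one-sided polar-coordinates inequality on the annulus 1/2 < |x| < 1 *)

Section Polar.
Context {R : realType} {n : nat}.
Local Notation V := ('rV[R]_(n + n)).
Local Notation lam := (@lebesgue_measure R).
Local Notation mR := (measurableTypeR R).
Variable G : V -> \bar R.
Hypotheses (G0 : forall x, (0 <= G x)%E) (mG : rmeasurable G).
Hypothesis Gsupp : forall x, ~~ (2^-1 < enorm x < 1) -> G x = 0%E.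

(* [F], [H], [K] integrate [G] along rays in three parametrizations of the radius:
   [rho], [s = rho / |x|], and [s] with [y = s *: x] as base point. *)
Let F (rho : mR) (x : V) : \bar R :=
  if (0 < (rho : R)) && (enorm x < 1) then G ((rho : R) *: ((enorm x)^-1 *: x)) else 0%E.
Let H (s : mR) (x : V) : \bar R :=
  if (0 < (s : R) <= 2) && (2^-1 < enorm x < 1) then G ((s : R) *: x) else 0%E.
Let K (s : mR) (y : V) : \bar R :=
  if (0 < (s : R) <= 2) && (enorm y < (s : R) < 2 * enorm y) then G y else 0%E.

Let msnd : @rmap R _ (mR * (n + n).-tuple mR)%type (n + n) (fun p => tup2row p.2).
Proof. by move=> i; exact: (measurableT_comp (rmap_tup2row i)). Qed.

Let menorm : measurable_fun setT
  (fun p : (mR * (n + n).-tuple mR)%type => enorm (tup2row p.2) : mR).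
Proof. exact: (measurable_enorm msnd). Qed.

Let mF : measurable_fun setT (fun p : (mR * (n + n).-tuple mR)%type => F p.1 (tup2row p.2)).
Proof.
apply: measurable_fun_ifT => //.
  by apply: measurable_and; exact: measurable_fun_ltr.
by apply: (rmeasurable_comp mG); exact: rmap_normalize.
Qed.

Let mH : measurable_fun setT (fun p : (mR * (n + n).-tuple mR)%type => H p.1 (tup2row p.2)).
Proof.
apply: measurable_fun_ifT => //.
  apply: measurable_and; apply: measurable_and; try exact: measurable_fun_ltr.
  exact: measurable_fun_ler.
by apply: (rmeasurable_comp mG); exact: rmap_scale.
Qed.

Let mK : measurable_fun setT (fun p : (mR * (n + n).-tuple mR)%type => K p.1 (tup2row p.2)).
Proof.
apply: measurable_fun_ifT => //; last exact: (rmeasurable_comp mG).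
apply: measurable_and; apply: measurable_and; try exact: measurable_fun_ltr.
  exact: measurable_fun_ler.
by apply: measurable_fun_ltr => //; exact: measurable_funM.
Qed.

Let F0 rho x : (0 <= F rho x)%E.
Proof. by rewrite /F; case: ifP. Qed.
Let H0 rho x : (0 <= H rho x)%E.
Proof. by rewrite /H; case: ifP. Qed.
Let K0 rho x : (0 <= K rho x)%E.
Proof. by rewrite /K; case: ifP. Qed.

Let mFx x : measurable_fun setT (F ^~ x).
Proof.
have := measurableT_comp mF (pair2_measurable (row2tup x)).
by rewrite (_ : _ \o _ = F ^~ x)//; apply/funext => s; rewrite /= row2tupK.
Qed.
Let mHx x : measurable_fun setT (H ^~ x).
Proof.
have := measurableT_comp mH (pair2_measurable (row2tup x)).
by rewrite (_ : _ \o _ = H ^~ x)//; apply/funext => s; rewrite /= row2tupK.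
Qed.
Let mKs s : rmeasurable (K s).
Proof. exact: (measurableT_comp mK (pair1_measurable s)). Qed.
Let mHs s : rmeasurable (H s).
Proof. exact: (measurableT_comp mH (pair1_measurable s)). Qed.

Let iintF : (\int[lam]_s iint (F s) = iint (fun x => \int[lam]_s F s x))%E.
Proof. exact: iint_exchange. Qed.

Let mintF : rmeasurable (fun x => \int[lam]_s F s x)%E.
Proof. exact: (@measurable_fun_fubini_tonelli_G _ _ _ _ _ lam _ mF). Qed.
Let mintH : rmeasurable (fun x => \int[lam]_s H s x)%E.
Proof. exact: (@measurable_fun_fubini_tonelli_G _ _ _ _ _ lam _ mH). Qed.
Let mintK : rmeasurable (fun x => \int[lam]_s K s x)%E.
Proof. exact: (@measurable_fun_fubini_tonelli_G _ _ _ _ _ lam _ mK). Qed.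

(** For y in the annulus, the values of s with |y| < s < 2|y| form an interval of length |y| > 1/2,
    and they satisfy s <= 2 because |y| < 1. Averaging over s thus loses at most a factor 2. *)
Let le_GK y : (G y <= 2%:E * \int[lam]_s K s y)%E.
Proof.
have [/andP[y1 y2]|/Gsupp->] := boolP (2^-1 < enorm y < 1); last first.
  by rewrite mule_ge0// integral_ge0.
have -> : (\int[lam]_s K s y = \int[lam]_s (G y * (\1_(`]enorm y, 2 * enorm y[%classic) s)%:E))%E.
  apply: eq_integral => s _; rewrite /K indicE mem_setE in_itv/=.
  case: (boolP (enorm y < s < 2 * enorm y)) => [/andP[s1 s2]|_]; last by rewrite andbF mule0.
  rewrite mule1 ifT// andbT; apply/andP; split; lra.
rewrite ge0_integralZl//; last first.
- exact/measurable_EFinP/measurable_indic.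
rewrite integral_indic// setIT [X in (_ * (_ * X))%E]lebesgue_measure_itv/= lte_fin.
rewrite ifT; last by lra.
rewrite -EFinB muleCA -[leLHS]mule1 -EFinM lee_wpmul2l// lee_fin; lra.
Qed.

(** The dilation y = s x turns |y| < s < 2|y| into 1/2 < |x| < 1; its Jacobian s^(2n) is at most
    2^(2n). *)
Let le_KH s : (iint (K s) <= (2 ^+ (n + n))%:E * iint (H s))%E.
Proof.
have [s02|s02] := boolP (0 < (s : R) <= 2); last first.
  rewrite iint0; first by rewrite mule_ge0 ?lee_fin ?exprn_ge0//; exact: iint_ge0.
  by move=> y; rewrite /K (negbTE s02).
have /andP[s0 s2] := s02.
have -> : (iint (H s) = ((s : R) ^- (n + n))%:E * iint (K s))%E.
  rewrite -(@iint_affine R s _ 0)//; apply: eq_iint => x.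
  rewrite addr0 /H /K enormZ (gtr0_norm s0) s02 /=; congr (if _ then _ else _).
  by rewrite mulrCA -[X in _ = (_ < X) && _]mulr1 -[X in _ = _ && (X < _)]mulr1
    !ltr_pM2l// andbC -ltr_pdivrMl// mulr1.
rewrite muleA -EFinM -[leLHS]mul1e lee_wpmul2r//; first exact: iint_ge0.
by rewrite lee_fin ler_pdivlMr ?exprn_gt0// mul1r lerXn2r ?nnegrE ?(ltW s0).
Qed.

(** The substitution rho = |x| s costs the factor 1/|x|, which is below 2 in the annulus. *)
Let le_HF x : (\int[lam]_s H s x <= 2%:E * \int[lam]_s F s x)%E.
Proof.
have [/andP[x1 x2]|xN] := boolP (2^-1 < enorm x < 1); last first.
  rewrite integral0_eq ?mule_ge0 ?integral_ge0// => s _.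
  by rewrite /H (negbTE xN) andbF.
have x0 : 0 < enorm x by lra.
apply: (@le_trans _ _ (\int[lam]_s F (enorm x * s + 0)%R x)%E).
  apply: ge0_le_integral => //.
    apply: (measurableT_comp (mFx x)).
    by apply: measurable_funD => //; exact: measurable_funM.
  move=> s _; rewrite /H; case: ifP => // /andP[/andP[s0 _] _].
  by rewrite /F x2 addr0 mulr_gt0// scalerA mulrAC divff ?gt_eqF// mul1r.
rewrite (@integral_affine R _ 0 (F ^~ x))//.
rewrite lee_wpmul2r ?integral_ge0// lee_fin -[leRHS]invrK lef_pV2 ?posrE//; lra.
Qed.

(** The constant is the product 2 * 2^(2n) * 2 of the losses in [le_GK], [le_KH] and [le_HF], with
    Tonelli exchanging the order of integration in between. *)
Lemma iint_le_radial :
  (iint G <= (2 ^+ (n + n).+2)%:E * \int[lam]_rho iint (fun x =>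
     if ((0 < (rho : R)) && (enorm x < 1))%R then G ((rho : R) *: ((enorm x)^-1 *: x))%R else 0))%E.
Proof.
have intK : (iint G <= 2%:E * \int[lam]_s iint (K s))%E.
  rewrite (iint_exchange K0 mK) -iintZ//; last by move=> x; exact: integral_ge0.
  by apply: le_iint => //; exact: measurable_funeM.
apply: (le_trans intK).
have intH : (\int[lam]_s iint (K s) <= (2 ^+ (n + n))%:E * \int[lam]_s iint (H s))%E.
  rewrite -ge0_integralZl_EFin; [|by []|by move=> s _; exact: iint_ge0
    |exact: measurable_iint|exact: exprn_ge0].
  apply: ge0_le_integral => //.
  - by move=> s _; exact: iint_ge0.
  - exact: measurable_iint.
  - by apply: measurable_funeM; exact: measurable_iint.
have intF : (\int[lam]_s iint (H s) <= 2%:E * \int[lam]_s iint (F s))%E.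
  rewrite (iint_exchange H0 mH) iintF -iintZ//; last by move=> x; exact: integral_ge0.
  by apply: le_iint => //; [move=> x; exact: integral_ge0|exact: measurable_funeM].
apply: (@le_trans _ _ (2%:E * ((2 ^+ (n + n))%:E * (2%:E * \int[lam]_s iint (F s))))%E).
  rewrite lee_wpmul2l// (le_trans intH)// lee_wpmul2l// lee_fin exprn_ge0//.
by rewrite !muleA -!EFinM -exprS -exprSr.
Qed.

End Polar.

(** * Compact balls, zero extensions and translations *)

Section ClosedBall.
Context {R : realType} {n : nat}.
Local Notation V := ('rV[R]_(n + n)).
Local Notation mR := (measurableTypeR R).

Lemma compact_cball (r : R) : compact [set x : V | enorm x <= r].
Proof.
apply: bounded_closed_compact; last first.
  apply: (@closed_comp _ _ (@enorm R n) [set y | y <= r]); last exact: closed_le.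
  by move=> x _; exact: enorm_continuous.
exists r; split=> [|M rM x /= xr]; first exact: num_real.
have [|/mx_norm_neq0[[i j] /= xE]] := eqVneq (mx_norm x) 0.
  by move=> x0; rewrite [`|x|]x0 (le_trans _ (ltW rM))// (le_trans (enorm_ge0 x)).
by rewrite [`|x|]xE (ord1 i) (le_trans (coord_le_enorm x j))// (le_trans xr)// ltW.
Qed.

Lemma continuous_ball_measurable (f : V -> R) :
  (forall x, ball1 x -> f @ x --> f x) ->
  measurable_fun setT (fun t => if enorm (tup2row t : V) < 1 then f (tup2row t) else 0 : mR).
Proof.
move=> cf; have := rmeasurable_if open_ball1 cf.
by under eq_fun do rewrite /ball1/= asboolb.
Qed.

Lemma continuous_ball_bounded (f : V -> R) (r : R) : r < 1 ->
  (forall x, ball1 x -> f @ x --> f x) ->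
  exists C, forall x : V, enorm x <= r -> f x <= C.
Proof.
move=> r1 cf; have [[x0 x0r]|E] := pselect (exists x : V, enorm x <= r); last first.
  by exists 0 => x xr; exfalso; apply: E; exists x.
have [|c _ Hc] := @compact_EVT_max V R f _ (ex_intro _ x0 x0r) (@compact_cball r).
  apply: continuous_in_subspaceT => x; rewrite inE => xr.
  by apply: cf; exact: le_lt_trans r1.
by exists (f c) => x xr; apply: Hc; rewrite inE.
Qed.

Lemma measurable_translate (f : V -> R) (a : V) :
  measurable_fun setT (fun t => f (tup2row t) : mR) ->
  measurable_fun setT (fun t => f (tup2row t + a) : mR).
Proof.
move=> mf; have mE : rmeasurable (EFin \o f) by exact/measurable_EFinP.
have ma : rmap (fun t : (n + n).-tuple mR => tup2row t + a).
  move=> i; under eq_fun do rewrite mxE.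
  by apply: measurable_funD => //; exact: rmap_tup2row.
by apply/measurable_EFinP; exact: (rmeasurable_comp mE ma).
Qed.

Lemma iint_translate (f : V -> R) (a : V) : (forall x, 0 <= f x) ->
  measurable_fun setT (fun t => f (tup2row t) : mR) ->
  iint (fun x => (f (x + a))%:E) = iint (fun x => (f x)%:E).
Proof.
move=> f0 mf; have := @iint_affine R 1 _ a (EFin \o f) ltr01.
rewrite expr1n invr1 mul1e => <-.
- by apply: eq_iint => x; rewrite scale1r.
- by move=> x; rewrite lee_fin.
- exact/measurable_EFinP.
Qed.

End ClosedBall.

(** * Second differences of the cutoff, and the integral over a thin shell *)

Section GreenBound.
Context {R : realType} {n : nat}.
Local Notation V := ('rV[R]_(n + n)).
Local Notation lam := (@lebesgue_measure R).
Local Notation mR := (measurableTypeR R).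
Local Notation e_ j := (delta_mx 0 j : V).

Definition cutoff (r : R) (x : V) : R := Num.max 0 (r ^+ 2 - enorm x ^+ 2).

Lemma cutoff_ge0 (r : R) (x : V) : 0 <= cutoff r x.
Proof. by rewrite /cutoff le_max lexx. Qed.

Lemma cutoff_eq0 (r : R) (x : V) : 0 <= r -> r <= enorm x -> cutoff r x = 0.
Proof.
move=> r0 rx; apply/max_idPl; rewrite subr_le0 lerXn2r ?nnegrE ?enorm_ge0//.
Qed.

Lemma cutoff_le1 (r : R) (x : V) : 0 <= r <= 1 -> cutoff r x <= 1.
Proof.
move=> /andP[r0 r1]; rewrite /cutoff ge_max ler01/= lerBlDr.
by rewrite (le_trans (exprn_ile1 2 r0 r1))// lerDl sqr_ge0.
Qed.

Lemma measurable_cutoff (r : R) : measurable_fun setT (fun t => cutoff r (tup2row t) : mR).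
Proof.
apply: measurable_maxr => //; apply: measurable_funB => //.
by apply: measurable_funX; apply: measurable_enorm; exact: rmap_tup2row.
Qed.

(* The second difference of the cutoff is at most [0] away from the sphere of radius [r],
   where the cutoff is concave, and the kink contributes [2 h]. *)
Lemma cutoff_second_diff (r h : R) (x : V) j : 0 < h -> 0 < r -> r + h <= 1 ->
  cutoff r (x - h *: e_ j) + cutoff r (x + h *: e_ j) <=
  2 * cutoff r x + (if r - h < enorm x < r + h then 2 * h else 0).
Proof.
move=> h0 r0 rh1.
have E1 := sqr_enormD_delta x h j.
have E2 := sqr_enormD_delta x (- h) j.
rewrite scaleNr in E2.
(* Here x and both neighbours lie where the cutoff is r^2 - |x|^2, whose second difference is -2
   h^2. *)
have [xlo|xhi] := leP (enorm x) (r - h).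
  have [] : enorm (x + h *: e_ j) <= r /\ enorm (x - h *: e_ j) <= r.
    have := enormD_delta x h j; have := enormD_delta x (- h) j.
    by rewrite scaleNr normrN gtr0_norm//; lra.
  move=> A B.
  have sq (y : V) : enorm y <= r -> cutoff r y = r ^+ 2 - enorm y ^+ 2.
    by move=> yr; apply/max_idPr; rewrite subr_ge0 lerXn2r ?nnegrE ?enorm_ge0 ?(ltW r0).
  rewrite /= addr0 !sq ?E1 ?E2//; last by lra.
  by have := sqr_ge0 h; lra.
have [xm|xbig] := ltP (enorm x) (r + h); last first.
  have [] : r <= enorm (x + h *: e_ j) /\ r <= enorm (x - h *: e_ j).
    have := enormD_delta (x + h *: e_ j) (- h) j; have := enormD_delta (x - h *: e_ j) h j.
    by rewrite scaleNr addrK subrK normrN gtr0_norm//; lra.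
  move=> A B; rewrite !cutoff_eq0 ?(ltW r0)//; last by lra.
  by rewrite mulr0 addr0.
(* In the shell, the neighbours have squared norm |x|^2 + h^2 plus or minus 2 y. Since max(0, 2y) =
   |y| + y, the two bounds add up to 2 c + 2|y|, and |y| <= h because |x| < r + h <= 1. *)
set y := h * x ord0 j; set c := cutoff r x.
have yh : `|y| <= h.
  rewrite normrM (gtr0_norm h0) -[leRHS]mulr1 ler_wpM2l ?(ltW h0)//.
  by rewrite (le_trans (coord_le_enorm x j))//; lra.
have y1 : y <= `|y| by exact: ler_norm.
have y2 : - y <= `|y| by rewrite -normrN ler_norm.
have c0 : 0 <= c := cutoff_ge0 r x.
have cs : r ^+ 2 - enorm x ^+ 2 <= c by rewrite /c /cutoff le_max lexx orbT.
have h2 := sqr_ge0 h.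
have A : cutoff r (x - h *: e_ j) <= c + `|y| + y.
  rewrite /cutoff E2 ge_max mulrN mulNr -mulrA -/y sqrrN; apply/andP; split; lra.
have B : cutoff r (x + h *: e_ j) <= c + `|y| - y.
  rewrite /cutoff E1 ge_max -mulrA -/y; apply/andP; split; lra.
rewrite /=; lra.
Qed.

Section ShellBound.
Variables (g : V -> R) (M : R).
Hypotheses (g0 : forall x, ball1 x -> 0 <= g x)
  (cg : forall x, ball1 x -> g @ x --> g x).
Hypothesis gM : forall r, 0 < r < 1 ->
  (iint (fun x : V => if (enorm x < 1)%R then (g (r *: ((enorm x)^-1 *: x))%R)%:E else 0)
    <= M%:E)%E.

Let G (x : V) : R := if enorm x < 1 then g x else 0.
Let S (r h : R) (x : V) : R := if r - h < enorm x < r + h then G x else 0.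

Let G0 x : 0 <= G x.
Proof. by rewrite /G; case: ifP => // /g0. Qed.

Let mG : measurable_fun setT (fun t => G (tup2row t) : mR).
Proof. exact: continuous_ball_measurable. Qed.

Lemma measurable_shell (r h : R) : measurable_fun setT (fun t => S r h (tup2row t) : mR).
Proof.
apply: measurable_fun_ifT => //; apply: measurable_and; apply: measurable_fun_ltr => //;
  by apply: measurable_enorm; exact: rmap_tup2row.
Qed.

(** Radii outside ]r - h, r + h[ contribute nothing, and on this interval of length 2 h each
    spherical integral is at most M; the factor 2 joins the 2^(2n+2) of [iint_le_radial]. *)
Lemma iint_shell_le (r h : R) : 0 < h -> 2^-1 < r - h -> r + h < 1 ->
  (iint (fun x => (S r h x)%:E) <= (2 ^+ (n + n).+3 * h * M)%:E)%E.
Proof.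
move=> h0 rh rh1.
have S0 x : 0 <= S r h x by rewrite /S; case: ifP.
have M0 : 0 <= M.
  have : 0 < (2^-1 : R) < 1 by apply/andP; split; lra.
  move=> /gM; rewrite -lee_fin; apply: le_trans; apply: iint_ge0 => x.
  case: ifPn => // x1; rewrite lee_fin g0// /ball1/= !enormZ.
  rewrite !ger0_norm ?invr_ge0 ?enorm_ge0//.
  have [->|xn0] := eqVneq (enorm x) 0; first by rewrite invr0 mul0r mulr0.
  rewrite mulVf// mulr1; lra.
have := @iint_le_radial R n (fun x => (S r h x)%:E).
have mS : rmeasurable (fun x => (S r h x)%:E) by apply/measurable_EFinP; exact: measurable_shell.
move=> /(_ (fun x => S0 x) mS) Hr; apply: (le_trans (Hr _)).
  move=> x xN; congr EFin; rewrite /S; case: ifPn => // /andP[x1 x2].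
  by move: xN; rewrite (lt_trans rh x1) (lt_trans x2 rh1).
have -> : 2 ^+ (n + n).+3 * h * M = 2 ^+ (n + n).+2 * (2 * h * M).
  by rewrite [in LHS]exprSr !mulrA.
rewrite [X in (_ <= X)%E]EFinM lee_wpmul2l ?lee_fin ?exprn_ge0//.
apply: (@le_trans _ _ (\int[lam]_rho (M%:E * (\1_(`]r - h, r + h[%classic) rho)%:E))%E); last first.
  rewrite ge0_integralZl//; last exact/measurable_EFinP/measurable_indic.
  rewrite integral_indic// setIT [X in (_ * X)%E]lebesgue_measure_itv/= lte_fin.
  rewrite ifT; last by lra.
  rewrite -EFinB -EFinM lee_fin; rewrite le_eqVlt; apply/orP; left; apply/eqP; lra.
apply: ge0_le_integral => //.
- by move=> rho _; apply: iint_ge0 => x; case: ifP => // _; rewrite lee_fin.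
- apply: measurable_iint => [rho x|]; first by case: ifP => // _; rewrite lee_fin.
  have msnd : @rmap R _ (mR * (n + n).-tuple mR)%type (n + n) (fun p => tup2row p.2).
    by move=> i; exact: (measurableT_comp (rmap_tup2row i)).
  apply: measurable_fun_ifT => //.
    apply: measurable_and; apply: measurable_fun_ltr => //.
    exact: (measurable_enorm msnd).
  by apply: (rmeasurable_comp mS); exact: rmap_normalize.
- by apply: measurable_funeM; exact/measurable_EFinP/measurable_indic.
move=> rho _; rewrite indicE mem_setE in_itv/=.
(* At x = 0 the convention 0^-1 = 0 makes the normalized point 0 instead of a unit vector; it lies
   outside the shell since r - h > 0. *)
have nz (x : V) : 0 < rho -> enorm (rho *: ((enorm x)^-1 *: x)) != 0 ->
    enorm (rho *: ((enorm x)^-1 *: x)) = rho.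
  move=> rho0; rewrite !enormZ ger0_norm ?(ltW rho0)// ger0_norm ?invr_ge0 ?enorm_ge0//.
  by have [->|xn0 _] := eqVneq (enorm x) 0; [rewrite mulr0 mulr0 eqxx|rewrite mulVf// mulr1].
have [/andP[r1 r2]|rN] := boolP (r - h < rho < r + h); rewrite ?mule1 ?mule0; last first.
  rewrite iint0// => x; case: ifPn => // /andP[rho0 x1]; rewrite /S.
  case: ifPn => // sx; exfalso.
  have e0 : enorm (rho *: ((enorm x)^-1 *: x)) != 0.
    by have /andP[s1 _] := sx; rewrite gt_eqF//; lra.
  by move: sx; rewrite (nz x rho0 e0) (negbTE rN).
have rho0 : 0 < rho by lra.
apply: le_trans (gM (r := rho) _); last by apply/andP; split; lra.
have rowp : rmap (fun t : (n + n).-tuple mR => rho *: ((enorm (tup2row t))^-1 *: tup2row t)).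
  by apply: rmap_normalize => //; exact: rmap_tup2row.
have lt1 (x : V) : enorm (rho *: ((enorm x)^-1 *: x)) < 1.
  have [->|/nz ->//] := eqVneq (enorm (rho *: ((enorm x)^-1 *: x))) 0; lra.
rewrite (@eq_iint _ _ (fun x : V => if (enorm x < 1)%R then (g _)%:E else _)
  (fun x => if (enorm x < 1)%R then (G (rho *: ((enorm x)^-1 *: x))%R)%:E else 0%E)); last first.
  by move=> x; rewrite /G lt1.
apply: le_iint.
- by move=> x; case: ifP => // _; rewrite lee_fin.
- under eq_fun do rewrite rho0 /=; apply: rmeasurable_ball; exact: (rmeasurable_comp mS).
- have mGE : rmeasurable (EFin \o G) by exact/measurable_EFinP.
  by apply: rmeasurable_ball; exact: (rmeasurable_comp mGE).
- move=> x; rewrite rho0 /=; case: ifP => // _; rewrite lee_fin /S.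
  by case: ifP.
Qed.

End ShellBound.

End GreenBound.

(** * The discrete Green inequality and the passage to the limit *)

Section Green.
Context {R : realType} {n : nat}.
Local Notation V := ('rV[R]_(n + n)).
Local Notation mR := (measurableTypeR R).
Local Notation e_ j := (delta_mx 0 j : V).
Variables (g K : V -> R) (M : R).
Hypotheses (g0 : forall x, ball1 x -> 0 <= g x)
  (cg : forall x, ball1 x -> g @ x --> g x)
  (K0 : forall x, ball1 x -> 0 <= K x)
  (cK : forall x, ball1 x -> K @ x --> K x).
Hypothesis gM : forall r, 0 < r < 1 ->
  (iint (fun x : V => if (enorm x < 1)%R then (g (r *: ((enorm x)^-1 *: x))%R)%:E else 0)
    <= M%:E)%E.
Hypothesis g2 : forall r, 0 < r < 1 -> exists2 d, 0 < d & forall h, 0 < h < d ->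
  forall x, enorm x <= r -> h ^+ 2 * (K x - 1) <=
    \sum_j (g (x + h *: e_ j) + g (x - h *: e_ j) - 2 * g x).

(** Extension by 0 makes the integrands global, so they can be translated; where the cutoff is
    nonzero, r + h < 1 keeps the neighbours of x in the ball and the extension is invisible. *)
Let G (x : V) : R := if enorm x < 1 then g x else 0.
Let L (x : V) : R := if enorm x < 1 then K x else 0.

Let G0 x : 0 <= G x.
Proof. by rewrite /G; case: ifP => // /g0. Qed.
Let L0 x : 0 <= L x.
Proof. by rewrite /L; case: ifP => // /K0. Qed.
Let mG : measurable_fun setT (fun t => G (tup2row t) : mR).
Proof. exact: continuous_ball_measurable. Qed.
Let mL : measurable_fun setT (fun t => L (tup2row t) : mR).
Proof. exact: continuous_ball_measurable. Qed.

(** The negative terms are moved across, so that both sides are sums of nonnegative functions and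
    can be integrated in the extended reals. *)
Let second_diff_lb r h x : 0 < r -> 0 < h -> r + h < 1 -> enorm x <= r ->
  h ^+ 2 * (K x - 1) <= \sum_j (g (x + h *: e_ j) + g (x - h *: e_ j) - 2 * g x) ->
  h ^+ 2 * L x + (n + n)%:R * 2 * G x <=
    \sum_j (G (x + h *: e_ j) + G (x - h *: e_ j)) + h ^+ 2.
Proof.
move=> r0 h0 rh1 xr.
have Gg (k : R) j : `|k| = h -> G (x + k *: e_ j) = g (x + k *: e_ j).
  by move=> kh; rewrite /G ifT// (le_lt_trans (enormD_delta _ _ _))// kh; lra.
have x1 : enorm x < 1 by lra.
rewrite sumrB sumr_const card_ord -mulr_natl /L /G x1.
under [in X in _ -> X]eq_bigr => j _.
  rewrite -[if enorm (_ + _) < 1 then _ else _]/(G _) -[if _ then g (x - _) else _]/(G (x - h *: e_ j)).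
  rewrite -scaleNr !Gg ?normrN ?gtr0_norm// scaleNr.
  over.
lra.
Qed.

(** The first constant comes from (2n) * 2h * (2^(2n+3) h M) after division by h^2; the volume comes
    from the slack 1 in [K x - 1], as the cutoff is at most 1 and supported in the ball. *)
Lemma iint_cutoff_le (r : R) : 3 / 4 < r < 1 ->
  (iint (fun x => (cutoff r x * L x)%:E) <=
   ((n + n)%:R * 2 ^+ (n + n).+4 * M + fine (vol_int (fun _ : V => 1%E)))%:E)%E.
Proof.
move=> /andP[r34 r1].
have r0 : 0 < r by lra.
have [|d d0 Hd] := g2 (r := r); first by rewrite r0.
(* The three bounds give h < d for [g2], r + h < 1, and r - h > 1/2 from r > 3/4. *)
pose h := Num.min (d / 2) (Num.min ((1 - r) / 2) 8^-1).
have h0 : 0 < h by rewrite /h !lt_min; apply/and3P; split; lra.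
have hd : h < d by rewrite (@le_lt_trans _ _ (d / 2)) ?ge_min ?lexx//; lra.
have hr : h <= (1 - r) / 2 by rewrite /h !ge_min lexx /= orbT.
have h8 : h <= 8^-1 by rewrite /h !ge_min lexx /= !orbT.
have mc := @measurable_cutoff R n r.
pose S (x : V) : R := if r - h < enorm x < r + h then G x else 0.
have S0 x : 0 <= S x by rewrite /S; case: ifP.
have mS : measurable_fun setT (fun t => S (tup2row t) : mR) := measurable_shell cg r h.
have iS : (iint (fun x => (S x)%:E) <= (2 ^+ (n + n).+3 * h * M)%:E)%E.
  by apply: (iint_shell_le g0 cg gM); lra.
pose N : R := (n + n)%:R.
have N0 : 0 <= N by rewrite ler0n.
pose IG := iint (fun x => (cutoff r x * G x)%:E).
pose IL := iint (fun x => (cutoff r x * L x)%:E).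
pose IC := iint (fun x : V => (cutoff r x)%:E : \bar R).
have mfG : measurable_fun setT (fun t => cutoff r (tup2row t) * G (tup2row t) : mR).
  exact: measurable_funM.
have mfL : measurable_fun setT (fun t => cutoff r (tup2row t) * L (tup2row t) : mR).
  exact: measurable_funM.
have cG0 x : 0 <= cutoff r x * G x by rewrite mulr_ge0// cutoff_ge0.
have cL0 x : 0 <= cutoff r x * L x by rewrite mulr_ge0// cutoff_ge0.
have cN (x : V) : r <= enorm x -> cutoff r x = 0 by apply: cutoff_eq0; exact: ltW.
have mball : rmeasurable (fun x : V => if enorm x < 1 then 1%E else 0%E : \bar R).
  by apply: rmeasurable_ball; exact: measurable_cst.
have c1 (x : V) : cutoff r x <= 1 by apply: cutoff_le1; lra.
(* Finiteness permits cancelling the common term [(N * 2)%:E * IG] of [lower] and [upper]. It holds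
   because the cutoff vanishes for |x| >= r and g is bounded on the compact ball of radius r. *)
have IGfin : IG \is a fin_num.
  have [C HC] := continuous_ball_bounded r1 cg.
  have C0 : 0 <= `|C| by [].
  rewrite ge0_fin_numE; last by apply: iint_ge0 => x; rewrite lee_fin.
  apply: (@le_lt_trans _ _ (`|C|%:E * vol_int (fun _ : V => 1%E))%E); last first.
    by rewrite lte_mul_pinfty// vol_ball_lty.
  rewrite -iintZ//; last by move=> x; case: ifP.
  apply: le_iint => [x|||x]; first by rewrite lee_fin.
  - exact/measurable_EFinP.
  - exact: measurable_funeM.
  - have [xr|xr] := ltP (enorm x) r; last first.
      by rewrite cN// mul0r mule_ge0//; case: ifP.
    rewrite /G ifT ?(lt_trans xr)// mule1 lee_fin -[leRHS]mul1r ler_pM ?cutoff_ge0//.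
      by rewrite g0// /ball1/= (lt_trans xr).
    by rewrite (le_trans (HC _ (ltW xr)))// ler_norm.
have ICle : (IC <= vol_int (fun _ : V => 1%E))%E.
  apply: le_iint => // [x||x]; first by rewrite lee_fin cutoff_ge0.
  - exact/measurable_EFinP.
  - have [xr|xr] := ltP (enorm x) r; first by rewrite ifT ?(lt_trans xr)// lee_fin.
    by rewrite cN//; case: ifP.
(* [A] carries the shifts on g and [B] carries them on the cutoff; [shift] below, equality of their
   integrals, is the discrete integration by parts. *)
pose A (x : V) : R := \sum_j (cutoff r x * G (x + h *: e_ j) + cutoff r x * G (x - h *: e_ j)).
pose B (x : V) : R := \sum_j (cutoff r (x - h *: e_ j) + cutoff r (x + h *: e_ j)) * G x.
have mA1 a : measurable_fun setT (fun t => cutoff r (tup2row t) * G (tup2row t + a) : mR).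
  by apply: measurable_funM => //; exact: (@measurable_translate _ _ G a mG).
have mB1 a : measurable_fun setT (fun t => cutoff r (tup2row t + a) * G (tup2row t) : mR).
  by apply: measurable_funM => //; exact: (@measurable_translate _ _ (cutoff r) a mc).
have mA : measurable_fun setT (fun t => A (tup2row t) : mR).
  by apply: measurable_sum => j; apply: measurable_funD; exact: mA1.
have mB : measurable_fun setT (fun t => B (tup2row t) : mR).
  apply: measurable_sum => j; under eq_fun do rewrite mulrDl.
  by apply: measurable_funD; exact: mB1.
have A0 x : 0 <= A x.
  by apply: sumr_ge0 => j _; rewrite addr_ge0// mulr_ge0// cutoff_ge0.
have B0 x : 0 <= B x.
  by apply: sumr_ge0 => j _; rewrite mulr_ge0// addr_ge0// cutoff_ge0.
have lower : ((h ^+ 2)%:E * IL + (N * 2)%:E * IG <=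
   iint (fun x => (A x)%:E) + (h ^+ 2)%:E * IC)%E.
  {
  rewrite -iintZ ?sqr_ge0//; last exact/measurable_EFinP.
  rewrite -iintZ ?mulr_ge0//; last exact/measurable_EFinP.
  rewrite -[X in (_ <= _ + X)%E]iintZ ?sqr_ge0//; last 2 first.
  - by move=> x; rewrite lee_fin cutoff_ge0.
  - exact/measurable_EFinP.
  rewrite -!iintD.
  - apply: le_iint => [x|||x].
    + by rewrite -!EFinM -EFinD lee_fin addr_ge0// mulr_ge0// ?sqr_ge0// mulr_ge0.
    + by apply: emeasurable_funD; apply: measurable_funeM; exact/measurable_EFinP.
    + apply: emeasurable_funD; first exact/measurable_EFinP.
      by apply: measurable_funeM; exact/measurable_EFinP.
    rewrite -!EFinM -!EFinD lee_fin.
    have [xr|xr] := ltP (enorm x) r; last first.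
      by rewrite cN// !mul0r !mulr0 !addr0.
    have -> : A x = cutoff r x * \sum_j (G (x + h *: e_ j) + G (x - h *: e_ j)).
      by rewrite mulr_sumr; apply: eq_bigr => j _; rewrite mulrDr.
    have H : h ^+ 2 * L x + N * 2 * G x <=
        \sum_j (G (x + h *: e_ j) + G (x - h *: e_ j)) + h ^+ 2.
      apply: (second_diff_lb r0) => //; [lra|exact: ltW|].
      by apply: Hd; [rewrite h0 hd|exact: ltW].
    have := ler_wpM2l (cutoff_ge0 r x) H; lra.
  all: first [exact/measurable_EFinP
    |by apply: measurable_funeM; exact/measurable_EFinP
    |by move=> x; rewrite lee_fin
    |by move=> x; rewrite -EFinM lee_fin; apply: mulr_ge0;
      rewrite ?sqr_ge0 ?cutoff_ge0 ?cL0 ?cG0// mulr_ge0].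
  }
have shift : iint (fun x => (A x)%:E) = iint (fun x => (B x)%:E).
  have tr a : iint (fun x => (cutoff r x * G (x + a))%:E) =
      iint (fun x => (cutoff r (x - a) * G x)%:E).
    rewrite -(@iint_translate _ _ (fun x => cutoff r (x - a) * G x) a).
    - by apply: eq_iint => x; rewrite addrK.
    - by move=> x; rewrite mulr_ge0// cutoff_ge0.
    - exact: mB1.
  transitivity (\sum_j iint (fun x => (cutoff r x * G (x + h *: e_ j) +
      cutoff r x * G (x - h *: e_ j))%:E))%E.
    rewrite -iint_sum; first by apply: eq_iint => x; rewrite sumEFin.
    - by move=> j x; rewrite lee_fin addr_ge0// mulr_ge0// cutoff_ge0.
    - by move=> j; apply/measurable_EFinP; apply: measurable_funD; exact: mA1.
  transitivity (\sum_j iint (fun x => ((cutoff r (x - h *: e_ j) +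
      cutoff r (x + h *: e_ j)) * G x)%:E))%E; last first.
    rewrite -iint_sum; first by apply: eq_iint => x; rewrite sumEFin.
    - by move=> j x; rewrite lee_fin mulr_ge0// addr_ge0// cutoff_ge0.
    - move=> j; apply/measurable_EFinP; under eq_fun do rewrite /= mulrDl.
      by apply: measurable_funD; exact: mB1.
  apply: eq_bigr => j _; have e1 x a : (0 <= (cutoff r x * G (x + a))%:E)%E.
    by rewrite lee_fin mulr_ge0// cutoff_ge0.
  have e2 x a : (0 <= (cutoff r (x + a) * G x)%:E)%E.
    by rewrite lee_fin mulr_ge0// cutoff_ge0.
  under eq_iint do rewrite EFinD.
  under [in RHS]eq_iint do rewrite mulrDl EFinD.
  rewrite !iintD => [|//| |//| |//| |//| ]; [by rewrite !tr opprK
    |by apply/measurable_EFinP; first [exact: mA1|exact: mB1]..].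
have upper : (iint (fun x => (B x)%:E) <=
    (N * 2)%:E * IG + (N * 2 * h)%:E * iint (fun x => (S x)%:E))%E.
  have nS x : (0 <= (S x)%:E)%E by rewrite lee_fin.
  have nG x : (0 <= (cutoff r x * G x)%:E)%E by rewrite lee_fin.
  have rS : rmeasurable (fun x => (S x)%:E) by exact/measurable_EFinP.
  have rG : rmeasurable (fun x => (cutoff r x * G x)%:E) by exact/measurable_EFinP.
  have N2 : 0 <= N * 2 by rewrite mulr_ge0.
  have N2h : 0 <= N * 2 * h by rewrite mulr_ge0// ltW.
  rewrite -(iintZ N2 nG rG) -(iintZ N2h nS rS) -iintD; first last.
  - exact: measurable_funeM.
  - by move=> x; rewrite mule_ge0.
  - exact: measurable_funeM.
  - by move=> x; rewrite mule_ge0.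
  apply: le_iint => [x|||x]; first by rewrite lee_fin.
  - exact/measurable_EFinP.
  - by apply: emeasurable_funD; apply: measurable_funeM; exact/measurable_EFinP.
  rewrite -!EFinM -!EFinD lee_fin.
  have -> : N * 2 * (cutoff r x * G x) + N * 2 * h * S x =
      \sum_(j < n + n) ((2 * cutoff r x + (if r - h < enorm x < r + h then 2 * h else 0)) * G x).
    rewrite sumr_const card_ord -mulr_natl -/N /S; case: ifP => _; ring.
  by apply: ler_sum => j _; rewrite ler_wpM2r// cutoff_second_diff//; lra.
have main : ((h ^+ 2)%:E * IL <= (N * 2 * h)%:E * iint (fun x => (S x)%:E) + (h ^+ 2)%:E * IC)%E.
  have fin : ((N * 2)%:E * IG)%E \is a fin_num by exact: fin_numM.
  rewrite -(leeD2lE _ _ fin) addeC (le_trans lower)// shift addeA leeD2r//.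
have volfin : vol_int (fun _ : V => 1%E) \is a fin_num.
  by rewrite ge0_fin_numE ?vol_ball_lty// ltW// vol_ball_gt0.
rewrite -(@lee_pmul2l _ (h ^+ 2)%:E)//; last by rewrite lte_fin exprn_gt0.
apply: (le_trans main).
rewrite [X in (_ <= _ * X)%E]EFinD muleDr//; apply: leeD.
  apply: (@le_trans _ _ ((N * 2 * h)%:E * (2 ^+ (n + n).+3 * h * M)%:E)%E).
    by rewrite lee_wpmul2l// lee_fin !mulr_ge0// ltW.
  rewrite -!EFinM lee_fin le_eqVlt; apply/orP; left; apply/eqP.
  by rewrite -/N [2 ^+ (n + n).+4]exprS; ring.
by rewrite fineK// lee_wpmul2l// lee_fin sqr_ge0.
Qed.

Lemma iint_dist_lty :
  (iint (fun x : V => if (enorm x < 1)%R then (dist1 x * K x)%:E else 0) < +oo)%E.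
Proof.
pose C := ((n + n)%:R * 2 ^+ (n + n).+4 * M + fine (vol_int (fun _ : V => 1%E)))%:E.
have mcL r : rmeasurable (fun x => (cutoff r x * L x)%:E).
  by apply/measurable_EFinP; apply: measurable_funM => //; exact: measurable_cutoff.
have cL0 r x : (0 <= (cutoff r x * L x)%:E)%E by rewrite lee_fin mulr_ge0// cutoff_ge0.
apply: (@le_lt_trans _ _ C); last exact: ltry.
apply: (@le_trans _ _ (iint (fun x => (cutoff 1 x * L x)%:E))).
  have E x : (if (enorm x < 1)%R then (dist1 x * K x)%:E else 0%E) = (dist1 x * L x)%:E.
    by rewrite /L; case: ifP; rewrite ?mulr0.
  apply: le_iint => // [x||x].
  - case: ifP => // x1; rewrite lee_fin mulr_ge0 ?K0// /dist1 subr_ge0 ltW//.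
  - under eq_fun do rewrite /= E; apply/measurable_EFinP; apply: measurable_funM => //.
    by apply: measurable_funB => //; apply: measurable_enorm; exact: rmap_tup2row.
  - rewrite E lee_fin ler_wpM2r// /dist1 /cutoff le_max expr1n; apply/orP.
    have [x1|x1] := leP (enorm x) 1; [right|left; lra].
    by rewrite lerD2l lerN2 expr2 ler_piMr// enorm_ge0.
(* The harmonic sequence is shifted by 4 so that every radius is at least 4/5, above the threshold
   3/4. *)
pose r (k : nat) : R := 1 - k.+4.+1%:R^-1.
have rinv (k : nat) : 0 < (k.+4.+1%:R^-1 : R) <= 5^-1.
  by rewrite invr_gt0 ltr0n/= lef_pV2 ?posrE ?ltr0n// ler_nat.
have r34 k : 3 / 4 < r k < 1.
  by have /andP[] := rinv k; rewrite /r; set t := _^-1 => ? ?; apply/andP; split; lra.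
have rpos k : 0 <= r k.
  by have /andP[rk _] := r34 k; rewrite (le_trans _ (ltW rk))// divr_ge0.
apply: (@iint_monotone R _ (fun k x => (cutoff (r k) x * L x)%:E)) => // [x j k jk|x|k].
- rewrite lee_fin ler_wpM2r// /cutoff ge_max !le_max lexx/=; apply/orP; right.
  rewrite lerD2r lerXn2r ?nnegrE//.
  by rewrite lerD2l lerN2 lef_pV2 ?posrE ?ltr0n// ler_nat !ltnS.
- apply: cvg_EFin; first exact: nearW.
  apply: cvgM; last exact: cvg_cst.
  have r1 : r k ^+ 2 - enorm x ^+ 2 @[k --> \oo] --> (1 ^+ 2 - enorm x ^+ 2 : R).
    apply: cvgB; last exact: cvg_cst.
    have : r k @[k --> \oo] --> (1 - 0 : R).
      apply: cvgB; first exact: cvg_cst.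
      by have := @cvg_harmonic R; rewrite -(cvg_shiftn 4); under eq_fun do rewrite addn4.
    by rewrite subr0 => r1; exact: (cvgM r1 r1).
  have mc : {for (1 ^+ 2 - enorm x ^+ 2 : R), continuous (fun s : R => Num.max 0 s)}.
    by apply: (@continuous_max _ _ (fun=> 0) id) => //; exact: cvg_cst.
  exact: (cvg_comp _ _ r1 mc).
- exact: iint_cutoff_le.
Qed.

End Green.

(** * One-variable calculus along coordinate lines *)

Section LineCalculus.
Context {R : realType}.

Lemma dist_half_le (a b c e : R) : `|a - b| < e / 2 -> `|a - c| < e / 2 -> b - e <= c.
Proof. by rewrite !ltr_norml => /andP[? ?] /andP[? ?]; lra. Qed.

(** The two difference quotients are the same function of h. This reduces partial derivatives to
    derivatives on the real line. *)
Lemma is_derive_lineP (W : normedModType R) (f : W -> R) (x v : W) (t df : R) :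
  is_derive t 1 (fun s => f (x + s *: v)) df <-> is_derive (x + t *: v) v f df.
Proof.
have E : (fun h : R => h^-1 *: (((fun s => f (x + s *: v)) \o shift t) (h *: (1 : R)) - f (x + t *: v)))
   = (fun h => h^-1 *: ((f \o shift (x + t *: v)) (h *: v) - f (x + t *: v))).
  apply/funext => h /=; congr (_ *: (f _ - _)).
  by rewrite [h *: (1 : R)]mulr1 scalerDl addrCA.
by split=> -[d1 d2]; split; move: d1 d2; rewrite /derivable /derive E.
Qed.

Lemma is_derive_line0 (W : normedModType R) (f : W -> R) (x v : W) (df : R) :
  is_derive (0 : R) 1 (fun s => f (x + s *: v)) df <-> is_derive x v f df.
Proof. by have := is_derive_lineP f x v 0 df; rewrite scale0r addr0. Qed.

Lemma cvg_powR (T : Type) (F : set_system T) (FF : Filter F) (S : T -> R) (s r : R) :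
  0 <= r -> (forall x, 0 <= S x) -> 0 <= s -> S x @[x --> F] --> s ->
  S x `^ r @[x --> F] --> s `^ r.
Proof.
move=> r0 S0; rewrite le_eqVlt => /predU1P[<-|s0] Ss.
  (* The exponent 0 is separate because 0 to the power 0 is 1 here; it occurs for p = 2, where p/2 -
     1 = 0. *)
  have [->|rn0] := eqVneq r 0.
    by under eq_fun do rewrite powRr0; rewrite powRr0; exact: cvg_cst.
  have rp : 0 < r by rewrite lt_neqAle eq_sym rn0.
  rewrite powR0//; apply/cvgrPdist_lt => e e0.
  have d0 : 0 < e `^ r^-1 by exact: powR_gt0.
  move/cvgrPdist_lt : Ss => /(_ _ d0); apply: filterS => x.
  rewrite !sub0r !normrN ger0_norm// ger0_norm ?powR_ge0// => Sx.
  have := @gt0_ltr_powR R r rp (S x) (e `^ r^-1) (S0 x) (ltW d0) Sx.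
  by rewrite -powRrM mulVf// powRr1// ltW.
have [/derivable1_diffP/differentiable_continuous + _] := is_derive1_powR r s0.
by move=> c; apply: (cvg_comp _ _ Ss c).
Qed.

(** Where F vanishes, the difference quotient of A F is A(t + h) times that of F, so continuity of A
    suffices. This handles zeros of f, where the power of the modulus need not be differentiable. *)
Lemma is_derive_mul0 (A F : R -> R) (t dF : R) :
  F t = 0 -> is_derive t 1 F dF -> A s @[s --> t] --> A t ->
  is_derive t 1 (fun s => A s * F s) (A t * dF).
Proof.
move=> F0 [dvF dF'] cA.
have lF : h^-1 *: ((F \o shift t) (h *: (1 : R)) - F t) @[h --> 0^'] --> dF.
  by rewrite -dF'; exact: dvF.
have ht : h *: (1 : R) + t @[h --> 0^'] --> t.
  have : h + t @[h --> (0 : R)^'] --> 0 + t.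
    by apply: cvgD; [exact: nbhs_dnbhs|exact: cvg_cst].
  by rewrite add0r; under eq_fun do rewrite -[X in X + _]mulr1.
have lA : A (h *: (1 : R) + t) @[h --> 0^'] --> A t by exact: cvg_comp ht cA.
have L : h^-1 *: (((fun s => A s * F s) \o shift t) (h *: (1 : R)) - A t * F t)
    @[h --> 0^'] --> A t * dF.
  rewrite [X in X @ _ --> _](_ : _ = (fun h => A (h *: (1 : R) + t) *
      (h^-1 *: ((F \o shift t) (h *: (1 : R)) - F t)))); first exact: cvgM.
  apply/funext => h /=; rewrite F0 mulr0 !subr0 /GRing.scale/=; ring.
by split; [exact: cvgP L|exact: cvg_lim L].
Qed.

(** The mean value theorem is used twice: on the symmetrization [psi] over [0, h], which yields s,
    and on [dphi] over [-s, s], which gives psi'(s) = 2 s (phi''(x) - c) >= 0. *)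
Lemma second_diff_ge (phi dphi ddphi : R -> R) (c h : R) : 0 < h ->
  (forall t : R, `|t| <= h -> is_derive t 1 phi (dphi t)) ->
  (forall t : R, `|t| <= h -> is_derive t 1 dphi (ddphi t)) ->
  (forall t, `|t| <= h -> c <= ddphi t) ->
  c * h ^+ 2 <= phi h + phi (- h) - 2 * phi 0.
Proof.
move=> h0 D1 D2 ch.
have cont (f df : R -> R) (a b : R) : - h <= a -> b <= h ->
    (forall t : R, `|t| <= h -> is_derive t 1 f (df t)) -> {within `[a, b], continuous f}.
  move=> ha hb Df; apply: continuous_in_subspaceT => t; rewrite inE/= in_itv/= => /andP[at' tb].
  have [|+ _] := Df t; first by rewrite ler_norml; apply/andP; split; lra.
  by move=> /derivable1_diffP/differentiable_continuous.
pose psi (t : R) := phi t + phi (- t) - c * t ^+ 2.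
have Dpsi (t : R) : `|t| <= h -> is_derive t 1 psi (dphi t - dphi (- t) - 2 * c * t).
  move=> th.
  have d1 := D1 t th; have d2 : is_derive (- t) 1 phi (dphi (- t)) by apply: D1; rewrite normrN.
  have d3 : is_derive t 1 (fun s => phi (- s)) (- dphi (- t)).
    have := @is_derive1_comp R phi -%R t (dphi (- t)) (- 1) d2 (is_deriveNid _ _).
    by rewrite mulrN1.
  have d4 : is_derive t 1 (fun s : R => c * s ^+ 2) (2 * c * t).
    by apply: is_derive_eq; rewrite /GRing.scale/=; ring.
  by apply: is_derive_eq.
have [t th||s] := @MVT R psi (fun t => dphi t - dphi (- t) - 2 * c * t) 0 h h0.
- by apply: Dpsi; move: th; rewrite in_itv/= ler_norml => /andP[? ?]; apply/andP; split; lra.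
- by apply: cont Dpsi => //; lra.
rewrite in_itv/= => /andP[s0 sh] E1.
have [| | |x] := @MVT R dphi ddphi (- s) s.
- lra.
- move=> t; rewrite in_itv/= => /andP[? ?]; apply: D2.
  by rewrite ler_norml; apply/andP; split; lra.
- by apply: cont D2; lra.
rewrite in_itv/= => /andP[xs1 xs2] E2.
have xh : `|x| <= h by rewrite ler_norml; apply/andP; split; lra.
have cs : c * (s *+ 2) <= ddphi x * (s *+ 2) by apply: ler_wpM2r; [rewrite mulrn_wge0// ltW|exact: ch].
have : 0 <= (dphi s - dphi (- s) - 2 * c * s) * h.
  apply: mulr_ge0; last exact: ltW.
  have -> : dphi s - dphi (- s) - 2 * c * s = ddphi x * (s *+ 2) - c * (s *+ 2).
    by rewrite E2; ring.
  by rewrite subr_ge0.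
move: E1; rewrite /psi oppr0 expr0n /=; lra.
Qed.

End LineCalculus.

(** * Derivatives of (a^2 + b^2)^q in one variable, zeros included *)

Section PowerOfModulus.
Context {R : realType}.

Lemma is_derive_cvg (f : R -> R) (t df : R) : is_derive t 1 f df -> f s @[s --> t] --> f t.
Proof. by move=> [/derivable1_diffP/differentiable_continuous]. Qed.

Section OneVariable.
Variables (a b : R -> R) (t da db q : R).
Hypotheses (Da : is_derive t 1 a da) (Db : is_derive t 1 b db) (q1 : 1 <= q).
Let S (s : R) := a s ^+ 2 + b s ^+ 2.

Let S0 s : 0 <= S s.
Proof. by rewrite addr_ge0 ?sqr_ge0. Qed.

Let DS : is_derive t 1 S (2 * (a t * da + b t * db)).
Proof. by rewrite /S; apply: is_derive_eq; rewrite /GRing.scale/=; ring. Qed.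

Let zero : S t = 0 -> a t = 0 /\ b t = 0.
Proof. by move/eqP; rewrite paddr_eq0 ?sqr_ge0// !sqrf_eq0 => /andP[/eqP -> /eqP ->]. Qed.

Let cP r : 0 <= r -> S s `^ r @[s --> t] --> S t `^ r.
Proof. by move=> r0; apply: cvg_powR => //; exact: is_derive_cvg DS. Qed.

Let DP r : 0 < S t -> is_derive t 1 (fun s => S s `^ r)
  (r * S t `^ (r - 1) * (2 * (a t * da + b t * db))).
Proof.
by move=> St; have := is_derive1_comp (is_derive1_powR r St) DS.
Qed.

Lemma is_derive_modulus_pow : is_derive t 1 (fun s => S s `^ q)
  (2 * q * (S t `^ (q - 1) * (a t * da + b t * db))).
Proof.
have [St|St] := ltP 0 (S t).
  by apply: is_derive_eq (DP q St) _; ring.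
have {}St : S t = 0 by apply/le_anti; rewrite St S0.
have [at0 bt0] := zero St.
rewrite (_ : (fun s => S s `^ q) = (fun s => S s `^ (q - 1) * S s)); last first.
  by apply/funext => s; rewrite [RHS]mulrC (mulr_powRB1 (S0 s) (lt_le_trans ltr01 q1)).
apply: is_derive_eq (is_derive_mul0 St DS _) _; first by apply: cP; rewrite subr_ge0.
by rewrite at0 bt0 !mul0r addr0 !mulr0.
Qed.

Variables (a1 b1 : R -> R) (d2a d2b : R).
Hypotheses (a1t : a1 t = da) (b1t : b1 t = db).
Hypotheses (Da1 : is_derive t 1 a1 d2a) (Db1 : is_derive t 1 b1 d2b).
Let B s := a s * a1 s + b s * b1 s.

(** At a zero of S also B vanishes, and [is_derive_mul0] leaves only S^(q-1) B'. The formula agrees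
    with this since division by 0 yields 0, which removes the quotient term. *)
Lemma is_derive_modulus_pow2 :
  is_derive t 1 (fun s => 2 * q * (S s `^ (q - 1) * B s))
  (2 * q * (2 * (q - 1) * (S t `^ (q - 1) * (B t ^+ 2 / S t))
     + S t `^ (q - 1) * (da ^+ 2 + db ^+ 2 + a t * d2a + b t * d2b))).
Proof.
have DB : is_derive t 1 B (da ^+ 2 + db ^+ 2 + a t * d2a + b t * d2b).
  by rewrite /B; apply: is_derive_eq; rewrite /GRing.scale/= a1t b1t; ring.
have Bt : B t = a t * da + b t * db by rewrite /B a1t b1t.
suff H : is_derive t 1 (fun s => S s `^ (q - 1) * B s)
    (2 * (q - 1) * (S t `^ (q - 1) * (B t ^+ 2 / S t))
     + S t `^ (q - 1) * (da ^+ 2 + db ^+ 2 + a t * d2a + b t * d2b)).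
  by apply: is_derive_eq.
have [St|St] := ltP 0 (S t).
  apply: is_derive_eq (is_deriveM (DP (q - 1) St) DB) _.
  have E : S t `^ (q - 1 - 1) = S t `^ (q - 1) / S t.
    have St0 : (q - 1 == 1) ==> (S t != 0) by rewrite (gt_eqF St) implybT.
    by rewrite (powRB St0) powRr1.
  rewrite E -Bt /GRing.scale/=.
  by field; rewrite gt_eqF.
have {}St : S t = 0 by apply/le_anti; rewrite St S0.
have [at0 bt0] := zero St.
apply: is_derive_eq (is_derive_mul0 _ DB _) _.
- by rewrite Bt at0 bt0 !mul0r addr0.
- by apply: cP; rewrite subr_ge0.
- by rewrite St invr0 !mulr0 add0r.
Qed.

End OneVariable.

End PowerOfModulus.

(** * The function |f|^p is twice continuously differentiable along each axis *)

Section ModulusPowerC2.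
Context {R : realType} {n : nat}.
Local Notation V := ('rV[R]_(n + n)).
Local Notation e_ j := (delta_mx 0 j : V).
Variables (u v : V -> R) (p : R).
Hypotheses (p2 : 2 <= p) (Cu : C2on ball1 u) (Cv : C2on ball1 v).
Local Notation q := (p / 2).

Let q1 : 1 <= q.
Proof. by rewrite ler_pdivlMr// mul1r. Qed.

Definition modulus_pow (y : V) : R := cabs (u y) (v y) `^ p.
Let S (y : V) : R := u y ^+ 2 + v y ^+ 2.
Let B j (y : V) : R := u y * pd j u y + v y * pd j v y.
Let G1 j (y : V) : R := 2 * q * (S y `^ (q - 1) * B j y).
Let C j (y : V) : R :=
  pd j u y ^+ 2 + pd j v y ^+ 2 + u y * pd j (pd j u) y + v y * pd j (pd j v) y.
(** The pure second partial derivative of |f|^p in direction j; at zeros of f the quotient by S is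
    read as 0. *)
Let w j (y : V) : R :=
  2 * q * (2 * (q - 1) * (S y `^ (q - 1) * (B j y ^+ 2 / S y)) + S y `^ (q - 1) * C j y).

Let S0 y : 0 <= S y.
Proof. by rewrite addr_ge0 ?sqr_ge0. Qed.

Let gE : modulus_pow = fun y => S y `^ q.
Proof.
apply/funext => y; rewrite /modulus_pow /cabs -powR12_sqrt ?S0// -powRrM.
by congr (_ `^ _); rewrite mulrC.
Qed.

Let Dpd (f : V -> R) j y : C1on ball1 f -> ball1 y -> is_derive y (e_ j) f (pd j f y).
Proof. by move=> [_ [df _]] yB; split => //; exact: df. Qed.

Let Du j y : ball1 y -> is_derive y (e_ j) u (pd j u y).
Proof. by case: Cu => Cu1 _; exact: Dpd. Qed.
Let Dv j y : ball1 y -> is_derive y (e_ j) v (pd j v y).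
Proof. by case: Cv => Cv1 _; exact: Dpd. Qed.
Let Du2 j y : ball1 y -> is_derive y (e_ j) (pd j u) (pd j (pd j u) y).
Proof. by case: Cu => _ Cu2; exact: Dpd. Qed.
Let Dv2 j y : ball1 y -> is_derive y (e_ j) (pd j v) (pd j (pd j v) y).
Proof. by case: Cv => _ Cv2; exact: Dpd. Qed.

Let Dg j y : ball1 y -> is_derive y (e_ j) modulus_pow (G1 j y).
Proof.
move=> yB; rewrite gE; apply/is_derive_line0.
have /is_derive_line0 a := Du j yB; have /is_derive_line0 b := Dv j yB.
apply: is_derive_eq (is_derive_modulus_pow a b q1) _.
by rewrite scale0r addr0.
Qed.

Let DG1 j y : ball1 y -> is_derive y (e_ j) (G1 j) (w j y).
Proof.
move=> yB; apply/is_derive_line0.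
have /is_derive_line0 a := Du j yB; have /is_derive_line0 b := Dv j yB.
have /is_derive_line0 a2 := Du2 j yB; have /is_derive_line0 b2 := Dv2 j yB.
have y0 : y + 0 *: e_ j = y by rewrite scale0r addr0.
have := is_derive_modulus_pow2 a b q1 (a1 := fun s => pd j u (y + s *: e_ j))
  (b1 := fun s => pd j v (y + s *: e_ j)).
by rewrite !y0 => /(_ _ _ erefl erefl a2 b2).
Qed.

Let cvg_u y : ball1 y -> u @ y --> u y.
Proof. by case: Cu => [[+ _] _]; exact. Qed.
Let cvg_v y : ball1 y -> v @ y --> v y.
Proof. by case: Cv => [[+ _] _]; exact. Qed.

Let cvg_sqr (T : Type) (F : set_system T) (FF : Filter F) (f : T -> R) (l : R) :
  f z @[z --> F] --> l -> f z ^+ 2 @[z --> F] --> l ^+ 2.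
Proof. by move=> fl; rewrite expr2; under eq_fun do rewrite expr2; exact: cvgM. Qed.

Let cvg_SF (y : V) (F : set_system V) (FF : Filter F) :
  u z @[z --> F] --> u y -> v z @[z --> F] --> v y -> S z @[z --> F] --> S y.
Proof. by move=> cu cv; apply: cvgD; exact: cvg_sqr. Qed.

Let cvg_S y : ball1 y -> S z @[z --> y] --> S y.
Proof. by move=> yB; exact: (cvg_SF (nbhs_filter y) (cvg_u yB) (cvg_v yB)). Qed.

Lemma modulus_pow_continuous y : ball1 y -> modulus_pow @ y --> modulus_pow y.
Proof.
move=> yB; rewrite gE; apply: (cvg_powR (nbhs_filter y) _ S0 (S0 y) (cvg_S yB)).
exact: le_trans q1.
Qed.

Let cvg_pd (f : V -> R) j y : C1on ball1 f -> ball1 y -> pd j f z @[z --> y] --> pd j f y.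
Proof. by move=> [_ [_ +]] yB; exact. Qed.

(** Only the term in B^2 / S at a zero of f is delicate. If q = 1 its coefficient is 0. Otherwise
    B^2 / S is at most the squared partial derivatives, which converge, while S^(q-1) tends to 0. *)
Let cvg_wF j (y : V) (F : set_system V) (FF : Filter F) :
  u z @[z --> F] --> u y -> v z @[z --> F] --> v y ->
  pd j u z @[z --> F] --> pd j u y -> pd j v z @[z --> F] --> pd j v y ->
  pd j (pd j u) z @[z --> F] --> pd j (pd j u) y ->
  pd j (pd j v) z @[z --> F] --> pd j (pd j v) y -> w j z @[z --> F] --> w j y.
Proof.
move=> cu cv cu1 cv1 cu2 cv2.
have q0 : 0 <= q - 1 by rewrite subr_ge0.
have cS := cvg_SF FF cu cv.
have cA := cvg_powR FF q0 S0 (S0 y) cS.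
have cB : B j z @[z --> F] --> B j y.
  exact: (cvgD (cvgM cu cu1) (cvgM cv cv1)).
have cuv : pd j u z ^+ 2 + pd j v z ^+ 2 @[z --> F] --> pd j u y ^+ 2 + pd j v y ^+ 2.
  exact: (cvgD (cvg_sqr FF cu1) (cvg_sqr FF cv1)).
have cC : C j z @[z --> F] --> C j y.
  exact: (cvgD (cvgD cuv (cvgM cu cu2)) (cvgM cv cv2)).
suff cE : 2 * (q - 1) * (S z `^ (q - 1) * (B j z ^+ 2 / S z)) @[z --> F] -->
    2 * (q - 1) * (S y `^ (q - 1) * (B j y ^+ 2 / S y)).
  exact: (cvgM (cvg_cst (2 * q)) (cvgD cE (cvgM cA cC))).
clear cC.
have [q1E|q1N] := eqVneq (q - 1) 0.
  rewrite q1E mulr0 mul0r; under eq_fun do rewrite mul0r; exact: cvg_cst.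
suff cE : S z `^ (q - 1) * (B j z ^+ 2 / S z) @[z --> F] -->
    S y `^ (q - 1) * (B j y ^+ 2 / S y).
  exact: (cvgM (cvg_cst (2 * (q - 1))) cE).
have [Sy|Sy] := ltP 0 (S y).
  have Sy0 : S y != 0 by rewrite gt_eqF.
  exact: (cvgM cA (cvgM (cvg_sqr FF cB) (cvgV Sy0 cS))).
have {}Sy : S y = 0 by apply/le_anti; rewrite Sy S0.
rewrite Sy powR0// mul0r.
have cD : S z `^ (q - 1) * (pd j u z ^+ 2 + pd j v z ^+ 2) @[z --> F] --> (0 : R).
  rewrite -(mul0r (pd j u y ^+ 2 + pd j v y ^+ 2)).
  by rewrite Sy powR0// in cA; exact: (cvgM cA cuv).
apply: (@squeeze_cvgr _ _ _ _ (fun=> 0) _ _ _ _ _ cD); last exact: cvg_cst.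
apply: nearW => z; rewrite mulr_ge0 ?powR_ge0 ?divr_ge0 ?sqr_ge0//=.
rewrite ler_wpM2l ?powR_ge0//.
have [Sz|Sz] := ltP 0 (S z); last first.
  have -> : S z = 0 by apply/le_anti; rewrite Sz S0.
  by rewrite invr0 mulr0 addr_ge0 ?sqr_ge0.
rewrite ler_pdivrMr// -subr_ge0.
(* Lagrange's identity, giving Cauchy-Schwarz in the plane. *)
have -> : (pd j u z ^+ 2 + pd j v z ^+ 2) * S z - B j z ^+ 2 =
    (u z * pd j v z - v z * pd j u z) ^+ 2 by rewrite /S /B; ring.
exact: sqr_ge0.
Qed.

Let cvg_w j y : ball1 y -> w j z @[z --> y] --> w j y.
Proof.
case: (Cu) (Cv) => Cu1 Cu2 [Cv1 Cv2] yB.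
apply: (@cvg_wF j y (nbhs y) (nbhs_filter y)).
- exact: cvg_u.
- exact: cvg_v.
- exact: cvg_pd.
- exact: cvg_pd.
- exact: cvg_pd.
- exact: cvg_pd.
Qed.

Lemma lap_modulus_pow y : ball1 y -> lap modulus_pow y = \sum_j w j y.
Proof.
move=> yB.
have E j : pd j (pd j modulus_pow) y = w j y.
  have [_ <-] := DG1 j yB; rewrite /pd.
  (* The formula for the first derivative holds only in the ball; openness provides it on a
     neighbourhood of y, enough to differentiate again. *)
  apply: near_eq_derive; near=> z.
  have zB : ball1 z by near: z; apply: open_nbhs_nbhs; split => //; exact: open_ball1.
  by have [_ <-] := Dg j zB.
rewrite /lap big_split big_split_ord; congr (_ + _); apply: eq_bigr => k _; exact: E.
Unshelve. all: by end_near. Qed.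

(** Continuity of the second derivatives gives the estimate for x near a point x0 and h small;
    compactness of the closed ball makes the threshold on h uniform in x. *)
Lemma modulus_pow_second_diff (r : R) : 0 < r < 1 -> exists2 d, 0 < d & forall h, 0 < h < d ->
  forall x, enorm x <= r -> h ^+ 2 * (lap modulus_pow x - 1) <=
    \sum_j (modulus_pow (x + h *: e_ j) + modulus_pow (x - h *: e_ j) - 2 * modulus_pow x).
Proof.
move=> /andP[r0 r1].
pose P (h : R) (x : V) := h ^+ 2 * (lap modulus_pow x - 1) <=
    \sum_j (modulus_pow (x + h *: e_ j) + modulus_pow (x - h *: e_ j) - 2 * modulus_pow x).
have : \forall h \near (0 : R)^'+, [set x | enorm x <= r] `<=` P h.
  move/compact_near_coveringP : (@compact_cball R n r); apply => x0 x0r.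
  have x0B : ball1 x0 by exact: le_lt_trans r1.
  (* There are 2n directions, each with error at most eps, so the total error stays below the slack
     1. *)
  pose eps : R := (n + n).+1%:R^-1.
  have eps0 : 0 < eps by rewrite invr_gt0.
  have : \forall y \near x0, ball1 y /\ forall j, `|w j x0 - w j y| < eps / 2.
    near=> y; split; first by near: y; apply: open_nbhs_nbhs; split => //; exact: open_ball1.
    near: y; apply: filter_forall => j.
    by move/cvgrPdist_lt : (@cvg_w j x0 x0B); apply; rewrite divr_gt0.
  move=> /nbhs_ballP[d /= d0 Hd].
  (* Halving d for both x and h keeps the whole segment from x - h e_j to x + h e_j in the ball of
     radius d about x0. *)
  exists (ball x0 (d / 2), [set h | 0 < h < d / 2]).
    split; first by apply: nbhsx_ballx; rewrite divr_gt0.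
    near=> h; apply/andP; split; near: h; [exact: nbhs_right_gt|].
    by apply: nbhs_right_lt; rewrite divr_gt0.
  move=> [x h] /= [xx0 /andP[h0 hd]].
  have near_x t j : `|t| <= h -> ball x0 d (x + t *: e_ j).
    move=> th; split=> // i k; case: xx0 => _ /(_ i k); rewrite /ball/= !mxE => xik.
    rewrite opprD addrA (splitr d) (le_lt_trans (ler_normB _ _))// ltr_leD//.
    rewrite (le_trans _ (ltW hd))// normrM (le_trans _ th)// -[leRHS]mulr1 ler_wpM2l//.
    by case: (_ && _); rewrite ?normr1 ?normr0.
  have xd : ball x0 d x.
    by case: xx0 => _ xx0; split=> // i k; apply: lt_trans (xx0 i k) _; lra.
  have [xB wx] := Hd _ xd.
  have key j : (w j x - eps) * h ^+ 2 <=
      modulus_pow (x + h *: e_ j) + modulus_pow (x - h *: e_ j) - 2 * modulus_pow x.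
    have := @second_diff_ge R (fun t => modulus_pow (x + t *: e_ j))
      (fun t => G1 j (x + t *: e_ j)) (fun t => w j (x + t *: e_ j)) (w j x - eps) h h0.
    rewrite scaleNr scale0r addr0; apply=> t th.
    - by apply/is_derive_lineP/Dg; have [] := Hd _ (near_x t j th).
    - by apply/is_derive_lineP/DG1; have [] := Hd _ (near_x t j th).
    - have [_ /(_ j)] := Hd _ (near_x t j th); exact: dist_half_le (wx j).
  rewrite /P lap_modulus_pow//.
  apply: le_trans (ler_sum _ (fun j _ => key j)).
  rewrite -mulr_suml mulrC ler_wpM2r ?sqr_ge0// sumrB lerD2l lerN2.
  rewrite sumr_const card_ord -mulr_natl ler_pdivrMr// mul1r ler_nat; exact: leqnSn.
move=> [d /= d0 Hd]; exists d => // h /andP[h0 hd] x xr.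
apply: Hd => //; rewrite /ball/= sub0r normrN gtr0_norm//.
Unshelve. all: by end_near. Qed.

End ModulusPowerC2.

(** * From the Hardy-type condition to the weighted integrals *)

Section Assembly.
Context {R : realType} {n : nat}.
Local Notation V := ('rV[R]_(n + n)).

Lemma intVN_lty (f : V -> \bar R) :
  (vol_int f < +oo)%E -> (0 <= vol_int f)%E -> (intVN f < +oo)%E.
Proof.
move=> foo f0; rewrite /intVN lte_mul_pinfty// lee_fin invr_ge0 fine_ge0//.
exact/ltW/vol_ball_gt0.
Qed.

Lemma Hg_mean_le (p : R) (u v : V -> R) : 2 <= p -> Hg p u v ->
  exists M, forall r, 0 < r < 1 ->
    (iint (fun x : V => if (enorm x < 1)%R
       then (modulus_pow u v p (r *: ((enorm x)^-1 *: x))%R)%:E else 0) <= M%:E)%E.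
Proof.
move=> p2 [Hfin [M HM]]; set vol := vol_int (fun _ : V => 1%E).
have volfin : vol \is a fin_num.
  by rewrite ge0_fin_numE ?vol_ball_lty// ltW// vol_ball_gt0.
have vol0 : 0 < fine vol by rewrite fine_gt0// vol_ball_gt0 vol_ball_lty.
(* The volume undoes the normalization of the measure and the power p undoes the root. Taking |M|
   provides the nonnegative base needed for monotonicity of the power. *)
exists (fine vol * `|M| `^ p) => r r01.
set I := iint _.
have I0 : (0 <= I)%E by apply: iint_ge0 => x; case: ifP => // _; rewrite lee_fin powR_ge0.
have E : Mpp p r u v = ((fine vol)^-1%:E * I)%E by [].
have Mfin : Mpp p r u v \is a fin_num.
  by rewrite ge0_fin_numE ?Hfin// E mule_ge0// lee_fin invr_ge0 ltW.
have p0 : 0 < p by apply: lt_le_trans p2.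
have Mle : (Mpp p r u v <= (`|M| `^ p)%:E)%E.
  rewrite -(fineK Mfin) lee_fin.
  have F0 : 0 <= fine (Mpp p r u v).
    by rewrite fine_ge0// E mule_ge0// lee_fin invr_ge0 ltW.
  rewrite -(powRr1 F0) -(mulVf (lt0r_neq0 p0)) powRrM ge0_ler_powR ?nnegrE ?powR_ge0//.
    exact: ltW.
  exact: le_trans (HM r r01) (ler_norm _).
have -> : I = ((fine vol)%:E * Mpp p r u v)%E.
  by rewrite E muleA -EFinM mulfV ?mul1e// gt_eqF.
by rewrite EFinM lee_wpmul2l// lee_fin ltW.
Qed.

(** Common core of both conclusions: k is ||D_f||^t1 or |f|^t2, and alpha is the infimum of its
    coefficient. Green's bound is applied to alpha k, then divided by alpha. *)
Lemma dist_integral_lty (p alpha : R) (u v k : V -> R) :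
  2 <= p -> C2on ball1 u -> C2on ball1 v -> Hg p u v ->
  (forall x, ball1 x -> 0 <= k x) -> (forall x, ball1 x -> k @ x --> k x) ->
  0 < alpha -> (forall x, ball1 x -> alpha * k x <= lap (modulus_pow u v p) x) ->
  (intVN (fun x => (dist1 x `^ 1 * k x)%:E) < +oo)%E.
Proof.
move=> p2 Cu Cv HM k0 ck a0 kle.
pose F (x : V) : \bar R := if enorm x < 1 then (dist1 x * (alpha * k x))%:E else 0%E.
have d0 (x : V) : enorm x < 1 -> 0 <= dist1 x by move=> x1; rewrite /dist1 subr_ge0 ltW.
have F0 x : (0 <= F x)%E.
  by rewrite /F; case: ifP => // x1; rewrite lee_fin mulr_ge0 ?d0// mulr_ge0 ?k0// ltW.
have mF : rmeasurable F.
  have -> : F = fun x => (dist1 x * (alpha * (if enorm x < 1 then k x else 0)))%:E.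
    by apply/funext => x; rewrite /F; case: ifP => //; rewrite !mulr0.
  apply/measurable_EFinP; apply: measurable_funM.
    by apply: measurable_funB => //; apply: measurable_enorm; exact: rmap_tup2row.
  by apply: measurable_funM => //; exact: continuous_ball_measurable.
have [M gM] := Hg_mean_le p2 HM.
have Foo : (iint F < +oo)%E.
  apply: (@iint_dist_lty R n (modulus_pow u v p) (fun x => alpha * k x) M) => //.
  - by move=> x _; exact: powR_ge0.
  - by move=> x; exact: modulus_pow_continuous.
  - by move=> x xB; rewrite mulr_ge0 ?k0// ltW.
  - move=> x xB; have gen (E : set_system V) : Filter E ->
        k z @[z --> E] --> k x -> alpha * k z @[z --> E] --> alpha * k x.
      by move=> FE c; exact: (cvgM (cvg_cst alpha) c).
    by apply: (gen (nbhs x) (nbhs_filter x)); exact: ck.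
  - move=> r r01; have [d dd Hd] := modulus_pow_second_diff p2 Cu Cv r01.
    exists d => // h hd x xr; apply: le_trans (Hd h hd x xr).
    rewrite ler_wpM2l ?sqr_ge0// lerD2r kle//.
    by apply: le_lt_trans xr _; have /andP[] := r01.
have E : vol_int (fun x => (dist1 x `^ 1 * k x)%:E) = (alpha^-1%:E * iint F)%E.
  rewrite -iintZ ?invr_ge0 ?(ltW a0)//; apply: eq_iint => x; rewrite /F.
  case: ifP => [x1|_]; last by rewrite mule0.
  by rewrite -EFinM powRr1 ?d0//; congr EFin; field; rewrite gt_eqF.
apply: intVN_lty; rewrite E; last by rewrite mule_ge0 ?lee_fin ?invr_ge0 ?(ltW a0)// iint_ge0.
by rewrite lte_mul_pinfty// lee_fin invr_ge0 ltW.
Qed.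

(** With a, b, c, d standing for u_x, u_y, v_x, v_y, the expression is |f_z|^2 + |f_zbar|^2, one
    summand of ||D_f||^2. *)
Lemma cvg_wirtinger (T : Type) (F : set_system T) (FF : Filter F) (a b c d : T -> R)
  (la lb lc ld : R) : a @ F --> la -> b @ F --> lb -> c @ F --> lc -> d @ F --> ld ->
  (a z + d z) / 2 * ((a z + d z) / 2) + (c z - b z) / 2 * ((c z - b z) / 2)
   + ((a z - d z) / 2 * ((a z - d z) / 2) + (c z + b z) / 2 * ((c z + b z) / 2)) @[z --> F] -->
  (la + ld) / 2 * ((la + ld) / 2) + (lc - lb) / 2 * ((lc - lb) / 2)
   + ((la - ld) / 2 * ((la - ld) / 2) + (lc + lb) / 2 * ((lc + lb) / 2)).
Proof.
move=> ca cb cc cd.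
have h (f : T -> R) (l : R) : f z @[z --> F] --> l -> f z / 2 * (f z / 2) @[z --> F] --> l / 2 * (l / 2).
  by move=> fl; apply: cvgM; apply: cvgM => //; exact: cvg_cst.
apply: cvgD; apply: cvgD.
- exact: (h (fun z => a z + d z) _ (cvgD ca cd)).
- exact: (h (fun z => c z - b z) _ (cvgB cc cb)).
- exact: (h (fun z => a z - d z) _ (cvgB ca cd)).
- exact: (h (fun z => c z + b z) _ (cvgD cc cb)).
Qed.

Lemma normDf_continuous (u v : V -> R) : C1on ball1 u -> C1on ball1 v ->
  forall x, ball1 x -> normDf u v @ x --> normDf u v x.
Proof.
move=> [_ [_ cu]] [_ [_ cv]] x xB.
pose Q (y : V) : R := \sum_(k < n)
  (cabs (fz_re u v k y) (fz_im u v k y) ^+ 2 + cabs (fzb_re u v k y) (fzb_im u v k y) ^+ 2).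
suff cQ : Q y @[y --> x] --> Q x.
  exact: (cvg_comp _ _ cQ (@sqrt_continuous R (Q x))).
have sqc (a b : R) : cabs a b ^+ 2 = a * a + b * b.
  by rewrite sqr_sqrtr ?addr_ge0 ?sqr_ge0// !expr2.
rewrite /Q; under eq_fun do under eq_bigr do rewrite !sqc.
under eq_bigr do rewrite !sqc.
apply: (@cvg_sumr R V (nbhs x) (nbhs_filter x)) => k.
have ux := cu (lshift n k) x xB; have uy := cu (rshift n k) x xB.
have vx := cv (lshift n k) x xB; have vy := cv (rshift n k) x xB.
rewrite /fz_re /fz_im /fzb_re /fzb_im.
exact: (cvg_wirtinger (nbhs_filter x) ux uy vx vy).
Qed.

Lemma modulus_pow_cvg (u v : V -> R) (t : R) (x : V) : 0 <= t ->
  u @ x --> u x -> v @ x --> v x -> modulus_pow u v t @ x --> modulus_pow u v t x.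
Proof.
move=> t0 cu cv.
have gen (F : set_system V) (FF : Filter F) : u z @[z --> F] --> u x ->
    v z @[z --> F] --> v x -> u z * u z + v z * v z @[z --> F] --> u x * u x + v x * v x.
  by move=> a b; apply: cvgD; exact: cvgM.
apply: (cvg_powR (nbhs_filter x) t0) => [y||]; try exact: sqrtr_ge0.
have := cvg_comp _ _ (gen _ (nbhs_filter x) cu cv) (@sqrt_continuous R _).
by rewrite /cabs !expr2.
Qed.

End Assembly.

Theorem theorem1p12 (R : realType) (n : nat) (p t1 t2 : R)
  (u v : 'rV[R]_(n + n) -> R) (a1 b1 c1 : 'rV[R]_(n + n) -> R) :
  (1 <= n)%N -> 2 <= p -> 0 < t1 -> 0 < t2 ->
  C2on ball1 u -> C2on ball1 v -> Hg p u v ->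
  (forall x, ball1 x -> 0 <= a1 x /\ 0 <= b1 x /\ 0 <= c1 x) ->
  (forall x, ball1 x ->
     [/\ (a1 @ x --> a1 x), (b1 @ x --> b1 x) & (c1 @ x --> c1 x)]) ->
  0 < inf (a1 @` ball1) + inf (b1 @` ball1) ->
  0 <= inf (c1 @` ball1) ->
  (forall x, ball1 x ->
     a1 x * normDf u v x `^ t1 + b1 x * cabs (u x) (v x) `^ t2 + c1 x
       <= lap (fun y => cabs (u y) (v y) `^ p) x) ->
  (0 < inf (a1 @` ball1) -> Dspace 1 t1 u v) /\
  (0 < inf (b1 @` ball1) -> bspace 1 t2 u v).
Proof.
move=> n1 p2 t1_gt0 t2_gt0 Cu Cv HM abc_ge0 _ _ _ ineq.
(* Nonnegativity bounds the image from below, so [inf] is a genuine lower bound and not a default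
   value. *)
have inf_le (a : 'rV[R]_(n + n) -> R) x : (forall y, ball1 y -> 0 <= a y) -> ball1 x ->
    inf (a @` ball1) <= a x.
  move=> a0 xB; apply: ge_inf; last by exists x.
  by exists 0 => _ [y yB <-]; exact: a0.
have a1_ge0 x : ball1 x -> 0 <= a1 x by move=> /abc_ge0[].
have b1_ge0 x : ball1 x -> 0 <= b1 x by move=> /abc_ge0[_ []].
have c1_ge0 x : ball1 x -> 0 <= c1 x by move=> /abc_ge0[_ []].
have [[Cu1 _] [Cv1 _]] := (Cu, Cv).
have cu : forall x, ball1 x -> u @ x --> u x by case: Cu1.
have cv : forall x, ball1 x -> v @ x --> v x by case: Cv1.
split=> [alpha_gt0|beta_gt0].
  split=> //; split=> //.
  apply: (@dist_integral_lty _ _ p (inf (a1 @` ball1)) u v (fun x => normDf u v x `^ t1)) => //.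
  - by move=> x _; exact: powR_ge0.
  - move=> x xB; apply: (cvg_powR (nbhs_filter x) (ltW t1_gt0)).
    + by move=> y; exact: sqrtr_ge0.
    + exact: sqrtr_ge0.
    + exact: normDf_continuous.
  (* The other two terms of the differential inequality are nonnegative and are dropped. *)
  - move=> x xB; apply: le_trans (ineq x xB).
    rewrite -addrA -[leLHS]addr0 lerD//.
      by rewrite ler_wpM2r ?powR_ge0// inf_le.
    by rewrite addr_ge0 ?c1_ge0// mulr_ge0 ?powR_ge0 ?b1_ge0.
do 2 split=> //.
apply: (@dist_integral_lty _ _ p (inf (b1 @` ball1)) u v (fun x => cabs (u x) (v x) `^ t2)) => //.
- by move=> x _; exact: powR_ge0.
- move=> x xB; exact: (@modulus_pow_cvg _ _ u v t2 x (ltW t2_gt0) (cu x xB) (cv x xB)).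
- move=> x xB; apply: le_trans (ineq x xB).
  rewrite -addrA addrCA -[leLHS]addr0 lerD//.
    by rewrite ler_wpM2r ?powR_ge0// inf_le.
  by rewrite addr_ge0 ?c1_ge0// mulr_ge0 ?powR_ge0 ?a1_ge0.
Qed.
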